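(* Let $A$ be a higher Auslander algebra that is QF-1. Then $A$ is the endomorphism algebra of an $n$-cluster tilting module (over some finite-dimensional algebra $B$, for some $n$) all of whose indecomposable direct summands are projective or injective.
   Context: Algebras are finite-dimensional connected algebras over a field $K$; modules are finitely generated. The dominant dimension $\operatorname{domdim}A$ is the smallest $n$ such that the term $I^n$ of a minimal injective coresolution $0\to A\to I^0\to I^1\to\cdots$ of the regular module is not projective ($\infty$ if there is none). $A$ is a higher Auslander algebra if $\operatorname{gldim}A=\operatorname{domdim}A\ge2$ (finite), or $A$ is semisimple. For $n\ge1$, a $B$-module $M$ is $n$-cluster tilting if $\operatorname{add}M=\{X : \operatorname{Ext}_B^i(X,M)=0,\ 1\le i\le n-1\}=\{X: \operatorname{Ext}_B^i(M,X)=0,\ 1\le i\le n-1\}$. An $A$-module $M$ is balanced if the canonical algebra homomorphism from $A$ to the double centralizer of $M$ (the endomorphism ring of $M$ as a module over $\operatorname{End}_A(M)$) is surjective. $A$ is QF-1 if all faithful left and right $A$-modules are balanced. *)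

(* Defs.v *)
From HB Require Import structures.
From mathcomp Require Import all_boot all_order all_algebra all_field.

Set Implicit Arguments.
Unset Strict Implicit.
Unset Printing Implicit Defensive.

Import GRing.Theory.
Local Open Scope ring_scope.

(* Left R-modules are [lmodType R]; right R-modules are left modules over the
   converse ring [R^c]. All notions below are relative to the category of
   finitely generated left modules. *)

Section Modules.
Variable R : nzRingType.
Implicit Types M N X Y : lmodType R.

Definition fin_gen M : Prop :=
  exists (n : nat) (s : 'I_n -> M),
    forall m : M, exists c : 'I_n -> R, m = \sum_(i < n) c i *: s i.

Definition zero_module M : Prop := forall x : M, x = 0.

Definition is_submodule M (U : M -> Prop) : Prop :=
  U 0 /\ forall (a : R) (x y : M), U x -> U y -> U (a *: x + y).

Definition surj M N (f : {linear M -> N}) : Prop := forall y, exists x, f x = y.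

Definition exact_at M N X (f : {linear M -> N}) (g : {linear N -> X}) : Prop :=
  forall y, g y = 0 <-> exists x, f x = y.

Definition projective M : Prop :=
  forall X Y, fin_gen X -> fin_gen Y ->
  forall (g : {linear X -> Y}) (f : {linear M -> Y}), surj g ->
  exists h : {linear M -> X}, forall m, g (h m) = f m.

Definition injective_module M : Prop :=
  forall X Y, fin_gen X -> fin_gen Y ->
  forall (g : {linear X -> Y}) (f : {linear X -> M}), injective g ->
  exists h : {linear Y -> M}, forall x, h (g x) = f x.

Definition direct_summand N M : Prop :=
  exists (N' : lmodType R) (f : {linear (N * N')%type -> M}), bijective f.

Definition in_add M X : Prop :=
  exists k : nat, direct_summand X {ffun 'I_k -> M}.

Definition indecomposable M : Prop :=
  ~ zero_module M /\
  forall (X Y : lmodType R) (f : {linear (X * Y)%type -> M}),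
    bijective f -> zero_module X \/ zero_module Y.

Definition simple_module M : Prop :=
  ~ zero_module M /\
  forall U : M -> Prop, is_submodule U ->
    (forall x, U x -> x = 0) \/ (forall x, U x).

Definition semisimple_module M : Prop :=
  exists (n : nat) (S : 'I_n -> lmodType R)
         (iota : forall i, {linear S i -> M}),
    [/\ forall i, simple_module (S i),
        forall m, exists x : forall i, S i, m = \sum_(i < n) iota i (x i)
      & forall x y : forall i, S i,
          \sum_(i < n) iota i (x i) = \sum_(i < n) iota i (y i) ->
          forall i, x i = y i].

Record proj_resolution M := ProjResolution {
  pres_obj : nat -> lmodType R;
  pres_d : forall i, {linear pres_obj i.+1 -> pres_obj i};
  pres_aug : {linear pres_obj 0%N -> M};
  pres_fg : forall i, fin_gen (pres_obj i);
  pres_proj : forall i, projective (pres_obj i);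
  pres_aug_surj : surj pres_aug;
  pres_exact0 : exact_at (pres_d 0%N) pres_aug;
  pres_exact : forall i, exact_at (pres_d i.+1) (pres_d i)
}.

Definition pdim_le M (n : nat) : Prop :=
  exists P : proj_resolution M,
    forall i, (n < i)%N -> zero_module (pres_obj P i).

Definition Ext_cocycle X M (P : proj_resolution X) (i : nat)
    (f : {linear pres_obj P i -> M}) : Prop :=
  forall x, f (pres_d P i x) = 0.

Definition Ext_coboundary X M (P : proj_resolution X) (i : nat) :
    {linear pres_obj P i -> M} -> Prop :=
  match i with
  | 0 => fun f => forall x, f x = 0
  | j.+1 => fun f => exists g : {linear pres_obj P j -> M},
                       forall x, f x = g (pres_d P j x)
  end.

(* Ext^i(X, M) = 0, i.e. H^i(Hom(P, M)) = 0. Finitely generated projective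
   resolutions exist over the (noetherian) rings considered, and the condition
   does not depend on P. *)
Definition Ext_zero (i : nat) X M : Prop :=
  forall (P : proj_resolution X) (f : {linear pres_obj P i -> M}),
    Ext_cocycle f -> Ext_coboundary f.

Definition essential_image M N (f : {linear M -> N}) : Prop :=
  forall U : N -> Prop, is_submodule U -> (exists y, U y /\ y <> 0) ->
  exists x, U (f x) /\ f x <> 0.

(* Minimality: I^0 is an injective envelope of M, and I^(i+1) is an injective
   envelope of the image of I^i -> I^(i+1). *)
Record min_inj_coresolution M := MinInjCoresolution {
  cores_obj : nat -> lmodType R;
  cores_d : forall i, {linear cores_obj i -> cores_obj i.+1};
  cores_aug : {linear M -> cores_obj 0%N};
  cores_fg : forall i, fin_gen (cores_obj i);
  cores_inj : forall i, injective_module (cores_obj i);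
  cores_aug_inj : injective cores_aug;
  cores_exact0 : exact_at cores_aug (cores_d 0%N);
  cores_exact : forall i, exact_at (cores_d i) (cores_d i.+1);
  cores_min0 : essential_image cores_aug;
  cores_min : forall i, essential_image (cores_d i)
}.

Definition cluster_tilting (n : nat) M : Prop :=
  [/\ fin_gen M,
      forall X, fin_gen X ->
        (in_add M X <-> forall i, (1 <= i <= n - 1)%N -> Ext_zero i X M)
    & forall X, fin_gen X ->
        (in_add M X <-> forall i, (1 <= i <= n - 1)%N -> Ext_zero i M X)].

Definition faithful_module M : Prop :=
  forall a : R, (forall m : M, a *: m = 0) -> a = 0.

Definition balanced M : Prop :=
  forall f : {additive M -> M},
    (forall (g : {linear M -> M}) (m : M), f (g m) = g (f m)) ->
    exists a : R, forall m, f m = a *: m.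

End Modules.

Section Rings.
Variable R : nzRingType.

Definition connected_ring : Prop :=
  forall e : R, e * e = e -> (forall x, e * x = x * e) -> e = 0 \/ e = 1.

(* [is_gldim R d] and [is_domdim R d] say that the dimension is the finite
   number d. *)
Definition is_gldim (d : nat) : Prop :=
  (forall M : lmodType R, fin_gen M -> pdim_le M d) /\
  forall e : nat,
    (forall M : lmodType R, fin_gen M -> pdim_le M e) -> (d <= e)%N.

Definition is_domdim (d : nat) : Prop :=
  exists I : min_inj_coresolution R^o,
    ~ projective (cores_obj I d) /\
    forall i, (i < d)%N -> projective (cores_obj I i).

Definition higher_Auslander : Prop :=
  (exists d : nat, [/\ (2 <= d)%N, is_gldim d & is_domdim d]) \/
  semisimple_module R^o.

Definition QF1 : Prop :=
  (forall M : lmodType R, fin_gen M -> faithful_module M -> balanced M) /\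
  (forall M : lmodType R^c, fin_gen M -> faithful_module M -> balanced M).

End Rings.

(* A is isomorphic to End_B(M) as a K-algebra; K acts on M through B, and the
   product of End_B(M) is composition of maps. *)
Definition is_End_algebra (K : fieldType) (A B : falgType K)
    (M : lmodType B) : Prop :=
  exists phi : A -> {linear M -> M},
    [/\ forall a b m, phi (a + b) m = phi a m + phi b m,
        forall (k : K) a m, phi (k *: a) m = (k%:A : B) *: phi a m,
        (forall m, phi 1 m = m) /\
        (forall a b m, phi (a * b) m = phi a (phi b m)),
        forall a b, phi a =1 phi b -> a = b
      & forall f : {linear M -> M}, exists a, phi a =1 f].

(* Main.v *)
(* With n = gldim A - 1 (and n = 1 if A is semisimple), choose a projective-
   injective A-module Q such that the first n + 1 terms of a minimal injective
   coresolution of A lie in add Q, put B = End_A(Q) and M = Q, regarded as a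
   B-module. The contravariant functors F = Hom_A(-, Q) and G = Hom_B(-, Q)
   exchange add Q with the projective B-modules and add A with add M. Since F is
   exact, applying F G to a projective presentation gives F G X = X for every X,
   so X lies in add M as soon as G X is projective.
   - If Ext^i(X, M) = 0 for 1 <= i < n, then G maps a projective resolution of X
     to a complex which shows that G X is an (n+1)-st syzygy, hence projective.
   - In any case G X is a second syzygy, so pd (G X) <= n - 1, and
     Ext^i_B(M, X) = Ext^i_A(G X, A) for 1 <= i < n. If these groups vanish,
     G X is projective.
   Now let N be an indecomposable summand of M, and S the simple top of G N. If
   Hom(Q, S) = 0 = Hom(S, Q), then the projection of the faithful module Q + S
   onto S lies in its double centralizer but is not multiplication by an element
   of A. By QF-1, either S is a quotient of Q, and then G N is a summand of Q and
   N is projective; or S embeds in Q. In the second case, for a monomorphism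
   X -> Y, no nonzero map from the cokernel C of G Y -> G X to Q exists, so
   Hom(G N, C) = 0 and maps X -> N extend to Y: N is injective. *)
Require Import Defs.
From HB Require Import structures.
From mathcomp Require Import all_boot all_order all_algebra all_field.
From mathcomp Require Import boolp.

Set Implicit Arguments.
Unset Strict Implicit.
Unset Printing Implicit Defensive.

Import GRing.Theory.
Local Open Scope ring_scope.

(** * Modules and linear maps *)

Definition lin (R : nzRingType) (M N : lmodType R) (f : M -> N)
    (Hf : linear f) : {linear M -> N} :=
  HB.pack f (GRing.isLinear.Build R M N *:%R f Hf).

Section LinearMaps.
Variable R : nzRingType.
Implicit Types M N X Y : lmodType R.

Lemma linZD M N (f : {linear M -> N}) a x y : f (a *: x + y) = a *: f x + f y.
Proof. exact: linearP. Qed.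

Lemma linZ M N (f : {linear M -> N}) a x : f (a *: x) = a *: f x.
Proof. exact: linearZ. Qed.

Fact lcomp_subproof M N X (g : {linear N -> X}) (f : {linear M -> N}) :
  linear (fun x => g (f x)).
Proof. by move=> a x y; rewrite !linZD. Qed.
Definition lcomp M N X (g : {linear N -> X}) (f : {linear M -> N}) :=
  lin (lcomp_subproof g f).

Fact lid_subproof M : linear (fun x : M => x). Proof. by []. Qed.
Definition lid M : {linear M -> M} := lin (@lid_subproof M).

Fact lzero_subproof M N : linear (fun _ : M => 0 : N).
Proof. by move=> a x y; rewrite scaler0 addr0. Qed.
Definition lzero M N : {linear M -> N} := lin (@lzero_subproof M N).

Fact ladd_subproof M N (f g : {linear M -> N}) : linear (fun x => f x + g x).
Proof. by move=> a x y; rewrite !linZD scalerDr addrACA. Qed.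
Definition ladd M N (f g : {linear M -> N}) := lin (ladd_subproof f g).

Fact lsub_subproof M N (f g : {linear M -> N}) : linear (fun x => f x - g x).
Proof. by move=> a x y; rewrite (linZD f) (linZD g) scalerBr opprD addrACA. Qed.
Definition lsub M N (f g : {linear M -> N}) := lin (lsub_subproof f g).

Fact lfst_subproof M N : linear (fun p : M * N => p.1). Proof. by []. Qed.
Definition lfst M N : {linear (M * N)%type -> M} := lin (@lfst_subproof M N).
Fact lsnd_subproof M N : linear (fun p : M * N => p.2). Proof. by []. Qed.
Definition lsnd M N : {linear (M * N)%type -> N} := lin (@lsnd_subproof M N).

Fact lpair_subproof M N X (f : {linear X -> M}) (g : {linear X -> N}) :
  linear (fun x => (f x, g x)).
Proof. by move=> a x y; rewrite !linZD. Qed.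
Definition lpair M N X (f : {linear X -> M}) (g : {linear X -> N})
  : {linear X -> (M * N)%type} := lin (lpair_subproof f g).

Fact fproj_subproof k M (i : 'I_k) : linear (fun x : {ffun 'I_k -> M} => x i).
Proof. by move=> a x y; rewrite !ffunE. Qed.
Definition fproj k M (i : 'I_k) : {linear {ffun 'I_k -> M} -> M} :=
  lin (@fproj_subproof k M i).
Arguments fproj {k M} i.

Fact ftup_subproof k M X (f : 'I_k -> {linear X -> M}) :
  linear (fun x => [ffun i => f i x]).
Proof. by move=> a x y; apply/ffunP => i; rewrite !ffunE linZD. Qed.
Definition ftup k M X (f : 'I_k -> {linear X -> M}) :
  {linear X -> {ffun 'I_k -> M}} := lin (ftup_subproof f).

Fact fsum_subproof k M X (f : 'I_k -> {linear M -> X}) :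
  linear (fun x : {ffun 'I_k -> M} => \sum_i f i (x i)).
Proof.
move=> a x y; rewrite scaler_sumr -big_split; apply: eq_bigr => i _ /=.
by rewrite !ffunE linZD.
Qed.
Definition fsum k M X (f : 'I_k -> {linear M -> X}) :
  {linear {ffun 'I_k -> M} -> X} := lin (fsum_subproof f).

Fact finj_subproof k M (i : 'I_k) :
  linear (fun x : M => [ffun j => if j == i then x else 0] : {ffun 'I_k -> M}).
Proof.
move=> a x y; apply/ffunP => j; rewrite !ffunE; case: (j == i) => //.
by rewrite scaler0 addr0.
Qed.
Definition finj k M (i : 'I_k) : {linear M -> {ffun 'I_k -> M}} :=
  lin (@finj_subproof k M i).
Arguments finj {k M} i.

Lemma fsum_finj k M X (f : 'I_k -> {linear M -> X}) i x :
  fsum f (finj i x) = f i x.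
Proof.
rewrite /= (bigD1 i) //= ffunE eqxx big1 ?addr0 // => j ji.
by rewrite ffunE (negbTE ji) linear0.
Qed.

Lemma fsum_proj k M X (h : {linear {ffun 'I_k -> M} -> X}) x :
  h x = fsum (fun i => lcomp h (finj i)) x.
Proof.
rewrite /= -linear_sum; congr (h _); apply/ffunP => i.
rewrite sum_ffunE (bigD1 i) //= ffunE eqxx big1 ?addr0 // => j ji.
by rewrite ffunE eq_sym (negbTE ji).
Qed.

Fact lscal_subproof M (m : M) : linear (fun a : R^o => a *: m).
Proof. by move=> a x y; rewrite scalerDl scalerA. Qed.
Definition lscal M (m : M) : {linear R^o -> M} := lin (lscal_subproof m).

Definition fcomb k M (s : 'I_k -> M) : {linear {ffun 'I_k -> R^o} -> M} :=
  fsum (fun i => lscal (s i)).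

Fact linv_subproof M N (f : {linear M -> N}) (g : N -> M) :
  cancel f g -> cancel g f -> linear g.
Proof.
by move=> fK gK a x y; rewrite -{1}(gK x) -{1}(gK y) -linZD fK.
Qed.

Lemma linear_inverse M N (f : {linear M -> N}) : bijective f ->
  exists g : {linear N -> M}, cancel f g /\ cancel g f.
Proof. by case=> g fK gK; exists (lin (linv_subproof fK gK)). Qed.

Lemma lin_inj M N (f : {linear M -> N}) :
  (forall x, f x = 0 -> x = 0) -> injective f.
Proof.
by move=> H x y E; apply/eqP; rewrite -subr_eq0; apply/eqP/H; rewrite linearB /= E subrr.
Qed.

Lemma inj_surj_bij M N (f : {linear M -> N}) :
  injective f -> surj f -> bijective f.
Proof.
move=> fi fs; have [g gP] := choice fs.
by exists g => // x; apply: fi; rewrite gP.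
Qed.

End LinearMaps.
Arguments fproj {R k M} i.
Arguments finj {R k M} i.

(** * Submodules and quotient modules *)

Record submod (R : nzRingType) (M : lmodType R) := Submod {
  sm_pred :> M -> Prop;
  sm_ok : is_submodule sm_pred }.

Section SubmoduleType.
Variables (R : nzRingType) (M : lmodType R) (U : submod M).

(** Submodules are arbitrary propositional predicates; classical reflection makes them boolean, so
    that the subtype inherits a module structure. *)
Definition sm_bool : pred M := fun x => `[< U x >].
Fact sm_closed : subsemimod_closed sm_bool.
Proof.
case: (sm_ok U) => U0 UD; apply: GRing.submod_closed_semi; split; first exact/asboolP.
by move=> a x y /asboolP Ux /asboolP Uy; apply/asboolP/UD.
Qed.
HB.instance Definition _ := GRing.isSubmodClosed.Build R M sm_bool sm_closed.
Definition smT := {x : M | sm_bool x}.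
HB.instance Definition _ := SubChoice.on smT.
HB.instance Definition _ := [SubChoice_isSubLmodule of smT by <:].

Fact sm_incl_subproof : linear (fun x : smT => \val x).
Proof. by move=> a x y; rewrite linearP. Qed.
Definition sm_incl : {linear smT -> M} := lin sm_incl_subproof.

Lemma sm_incl_inj : injective sm_incl. Proof. exact: val_inj. Qed.
Lemma sm_inclP x : U (sm_incl x).
Proof. exact/asboolP/(valP x). Qed.
Lemma sm_incl_ex x : U x -> exists y, sm_incl y = x.
Proof. by move=> Ux; exists (exist _ x (asboolT Ux)). Qed.

Lemma sm_factor (X : lmodType R) (f : {linear X -> M}) :
  (forall x, U (f x)) -> exists g : {linear X -> smT}, forall x, sm_incl (g x) = f x.
Proof.
move=> H; have Hl : linear (fun x => exist _ (f x) (asboolT (H x)) : smT).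
  by move=> a x y; apply: sm_incl_inj; rewrite [RHS]linZD; exact: linZD.
by exists (lin Hl).
Qed.
End SubmoduleType.

Section QuotientType.
Variables (R : nzRingType) (M : lmodType R) (U : submod M).

(** A canonical representative of the coset of [x]: [choose] depends only on the predicate as long
    as its default satisfies it. The quotient is carried by the fixed points of [qrep]. *)
Definition qrep (x : M) : M := choose (fun y => `[< U (x - y) >]) x.
Lemma sm0 : U 0. Proof. by case: (sm_ok U). Qed.
Lemma smD x y : U x -> U y -> U (x + y).
Proof. by move=> Ux Uy; rewrite -[x]scale1r; apply: (proj2 (sm_ok U)). Qed.
Lemma smZ a x : U x -> U (a *: x).
Proof. by move=> Ux; rewrite -[_ *: _]addr0; apply: (proj2 (sm_ok U)) => //; exact: sm0. Qed.
Lemma smN x : U x -> U (- x).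
Proof. by move=> Ux; rewrite -scaleN1r; apply: smZ. Qed.

Lemma qrepP x : U (x - qrep x).
Proof.
apply/asboolP; apply: (@chooseP _ (fun y => `[< U (x - y) >])).
by apply/asboolP; rewrite subrr; exact: sm0.
Qed.
Lemma qrep_eq x y : U (x - y) -> qrep x = qrep y.
Proof.
move=> Uxy; rewrite /qrep.
have E : (fun z => `[< U (x - z) >]) =1 (fun z => `[< U (y - z) >]).
  move=> z; apply/asboolP/asboolP => H.
    by rewrite -(subrKA x); apply: smD => //; rewrite -opprB; apply: smN.
  by rewrite -(subrKA y); apply: smD.
rewrite (eq_choose E); apply: choose_id => //.
  by apply/asboolP; rewrite -opprB; apply: smN.
by apply/asboolP; rewrite subrr; exact: sm0.
Qed.
Lemma qrepK x : qrep (qrep x) = qrep x.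
Proof. by apply: qrep_eq; rewrite -opprB; apply/smN/qrepP. Qed.

Definition quot := {x : M | qrep x == x}.
HB.instance Definition _ := SubChoice.on quot.
Definition qpi (x : M) : quot := exist _ (qrep x) (introT eqP (qrepK x)).
Lemma val_qpi x : \val (qpi x) = qrep x. Proof. by []. Qed.
Lemma qpi_surj (q : quot) : qpi (\val q) = q.
Proof. by apply: val_inj; rewrite val_qpi; apply/eqP/(valP q). Qed.
Lemma qpi_eq x y : qpi x = qpi y <-> U (x - y).
Proof.
split=> [/(congr1 val)|H]; last by apply: val_inj; rewrite !val_qpi; apply: qrep_eq.
rewrite !val_qpi => E; rewrite -(subrKA (qrep x)) {2}E; apply: smD; first exact: qrepP.
by rewrite -opprB; apply/smN/qrepP.
Qed.
Let qadd (p q : quot) := qpi (\val p + \val q).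
Let qopp (p : quot) := qpi (- \val p).
Let qscale a (p : quot) := qpi (a *: \val p).
Let qrepN x : U (qrep x - x).
Proof. by rewrite -[qrep x - x]opprB; apply/smN/qrepP. Qed.
Let qaddE x y : qadd (qpi x) (qpi y) = qpi (x + y).
Proof.
apply/qpi_eq; rewrite !val_qpi opprD addrACA.
by apply: smD.
Qed.
Let qoppE x : qopp (qpi x) = qpi (- x).
Proof. by apply/qpi_eq; rewrite !val_qpi -opprD; apply: smN. Qed.
Let qscaleE a x : qscale a (qpi x) = qpi (a *: x).
Proof. by apply/qpi_eq; rewrite !val_qpi -scalerBr; apply: smZ. Qed.
Let qind (P : quot -> Prop) : (forall x, P (qpi x)) -> forall q, P q.
Proof. by move=> H q; rewrite -(qpi_surj q). Qed.

Fact qaddA : associative qadd.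
Proof. by elim/qind => x; elim/qind => y; elim/qind => z; rewrite !qaddE addrA. Qed.
Fact qaddC : commutative qadd.
Proof. by elim/qind => x; elim/qind => y; rewrite !qaddE addrC. Qed.
Fact qadd0 : left_id (qpi 0) qadd.
Proof. by elim/qind => x; rewrite !qaddE add0r. Qed.
Fact qaddN : left_inverse (qpi 0) qopp qadd.
Proof. by elim/qind => x; rewrite qoppE qaddE addNr. Qed.
HB.instance Definition _ := GRing.isZmodule.Build quot qaddA qaddC qadd0 qaddN.
Let qplusE x y : qpi x + qpi y = qpi (x + y). Proof. exact: qaddE. Qed.
Fact qscaleA a b v : qscale a (qscale b v) = qscale (a * b) v.
Proof. by elim/qind: v => x; rewrite !qscaleE scalerA. Qed.
Fact qscale1 : left_id 1 qscale.
Proof. by elim/qind => x; rewrite !qscaleE scale1r. Qed.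
Fact qscaleDr : right_distributive qscale +%R.
Proof. by move=> a; elim/qind => x; elim/qind => y; rewrite !(qscaleE, qplusE) scalerDr. Qed.
Fact qscaleDl v : {morph qscale^~ v : a b / a + b}.
Proof. by elim/qind: v => x a b; rewrite !(qscaleE, qplusE) scalerDl. Qed.
HB.instance Definition _ := GRing.Zmodule_isLmodule.Build R quot
  qscaleA qscale1 qscaleDr qscaleDl.

Fact quot_pi_subproof : linear qpi.
Proof. by move=> a x y; rewrite -qplusE -qscaleE. Qed.
Definition quot_pi : {linear M -> quot} := lin quot_pi_subproof.
Lemma quot_pi_surj : surj quot_pi.
Proof. by move=> q; exists (\val q); exact: qpi_surj. Qed.
Lemma quot_pi0 x : quot_pi x = 0 <-> U x.
Proof. by rewrite -[X in _ <-> U X]subr0; apply: (qpi_eq x 0). Qed.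
End QuotientType.

(** * Exact sequences, retracts, projective and injective modules *)

Section Basics.
Variable R : nzRingType.
Implicit Types M N X Y Z P Q C : lmodType R.

Fact ker_subproof M N (f : {linear M -> N}) : is_submodule (fun x => f x = 0).
Proof.
by split=> [|a x y fx fy]; rewrite ?linear0 // linZD fx fy scaler0 addr0.
Qed.
Definition ker_sm M N (f : {linear M -> N}) := Submod (ker_subproof f).

Fact im_subproof M N (f : {linear M -> N}) :
  is_submodule (fun y => exists x, f x = y).
Proof.
split=> [|a _ _ [x <-] [y <-]]; first by exists 0; rewrite linear0.
by exists (a *: x + y); rewrite linZD.
Qed.
Definition im_sm M N (f : {linear M -> N}) := Submod (im_subproof f).

Definition ses M N X (i : {linear M -> N}) (p : {linear N -> X}) : Prop :=
  [/\ injective i, surj p & exact_at i p].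

(** Direct summands in a form that composes and passes through functors; [retract_summand] and
    [summand_retract] compare it with [direct_summand]. *)
Definition retract X Z : Prop :=
  exists (s : {linear X -> Z}) (r : {linear Z -> X}), forall x, r (s x) = x.

Lemma ker_exact M N (f : {linear M -> N}) : exact_at (sm_incl (ker_sm f)) f.
Proof.
move=> y; split=> [fy|[x <-]]; first exact: (@sm_incl_ex _ _ (ker_sm f)).
exact: (sm_inclP x).
Qed.

Lemma ker_ses M N (f : {linear M -> N}) : surj f -> ses (sm_incl (ker_sm f)) f.
Proof. by move=> fs; split=> //; [exact: sm_incl_inj | exact: ker_exact]. Qed.

Lemma coker_exact M N (f : {linear M -> N}) : exact_at f (quot_pi (im_sm f)).
Proof. by move=> y; exact: (quot_pi0 (im_sm f) y). Qed.

Lemma factor_surj M N X (p : {linear M -> N}) (f : {linear M -> X}) :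
  surj p -> (forall x, p x = 0 -> f x = 0) ->
  exists g : {linear N -> X}, forall x, g (p x) = f x.
Proof.
move=> /choice [s sP] H.
have E x y : p x = p y -> f x = f y.
  move=> pxy; apply/eqP; rewrite -subr_eq0 -linearB; apply/eqP/H.
  by rewrite linearB /= pxy subrr.
have Hl : linear (fun y => f (s y)).
  by move=> a x y; rewrite -linZD; apply: E; rewrite linZD !sP.
by exists (lin Hl) => x; apply: E; rewrite sP.
Qed.

Lemma factor_inj M N X (i : {linear M -> N}) (f : {linear X -> N}) :
  injective i -> (forall x, exists y, i y = f x) ->
  exists g : {linear X -> M}, forall x, i (g x) = f x.
Proof.
move=> ii /choice [s sP].
have Hl : linear s by move=> a x y; apply: ii; rewrite linZD !sP linZD.
by exists (lin Hl).
Qed.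

Lemma retract_refl X : retract X X.
Proof. by exists (lid X), (lid X). Qed.

Lemma retract_trans X Y Z : retract X Y -> retract Y Z -> retract X Z.
Proof.
move=> [s [r rs]] [s' [r' rs']]; exists (lcomp s' s), (lcomp r r') => x /=.
by rewrite rs' rs.
Qed.

Lemma retract_iso X Y (f : {linear X -> Y}) : bijective f ->
  retract X Y /\ retract Y X.
Proof.
move=> /linear_inverse [g [fK gK]]; split; first by exists f, g.
by exists g, f.
Qed.

(** The complement is the kernel of the retraction. *)
Lemma retract_summand X Z : retract X Z -> direct_summand X Z.
Proof.
move=> [s [r rs]]; exists (smT (ker_sm r)).
exists (ladd (lcomp s (@lfst _ _ _)) (lcomp (sm_incl (ker_sm r)) (@lsnd _ _ _))).
apply: inj_surj_bij.
  apply: lin_inj => -[x n] /= E.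
  have rn : r (sm_incl (ker_sm r) n) = 0 by exact: (sm_inclP n).
  have x0 : x = 0 by have := congr1 r E; rewrite linearD /= rs rn addr0 linear0.
  have n0 : n = 0.
    by apply: sm_incl_inj; rewrite linear0; move: E; rewrite x0 linear0 add0r.
  by rewrite x0 n0.
move=> z; have /(@sm_incl_ex _ _ (ker_sm r)) [n nE] : r (z - s (r z)) = 0.
  by rewrite linearB /= rs subrr.
exists (r z, n); change (s (r z) + sm_incl (ker_sm r) n = z).
by rewrite nE addrC subrK.
Qed.

Lemma summand_retract X Z : direct_summand X Z -> retract X Z.
Proof.
move=> [N' [f /linear_inverse [g [fK gK]]]].
exists (lcomp f (lpair (lid X) (lzero _ _))), (lcomp (@lfst _ _ _) g) => x /=.
by rewrite fK.
Qed.

Lemma fin_genT M (I : finType) (s : I -> M) :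
  (forall m, exists c : I -> R, m = \sum_i c i *: s i) -> fin_gen M.
Proof.
move=> H; exists #|I|, (fun i => s (enum_val i)) => m.
have [c ->] := H m; exists (fun i => c (enum_val i)).
by rewrite (reindex _ (onW_bij _ (enum_val_bij _))).
Qed.

Lemma fg_surj M N (f : {linear M -> N}) : surj f -> fin_gen M -> fin_gen N.
Proof.
move=> fs [n [s sP]]; exists n, (fun i => f (s i)) => y.
have [x <-] := fs y; have [c ->] := sP x; exists c.
by rewrite linear_sum; apply: eq_bigr => i _; rewrite linearZ.
Qed.

Lemma fg_retract X Z : retract X Z -> fin_gen Z -> fin_gen X.
Proof. by move=> [s [r rs]]; apply: (@fg_surj _ _ r) => x; exists (s x). Qed.

Lemma fg_regular : fin_gen R^o.
Proof.
exists 1%N, (fun _ => 1) => m; exists (fun _ => m).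
by rewrite big_ord1 /GRing.scale /= mulr1.
Qed.

Lemma fg_pow k M : fin_gen M -> fin_gen {ffun 'I_k -> M}.
Proof.
move=> [n [s sP]].
apply: (@fin_genT _ ('I_k * 'I_n)%type (fun p => finj p.1 (s p.2))) => m.
have [c cP] := choice (fun i => sP (m i)); exists (fun p => c p.1 p.2).
rewrite -(pair_bigA _ (fun i j => c i j *: finj i (s j))) /=.
have -> : m = \sum_i finj i (m i).
  have := fsum_proj (lid _) m; rewrite /= => {1}->.
  by apply: eq_bigr.
apply: eq_bigr => i _; rewrite [in LHS]cP linear_sum; apply: eq_bigr => j _.
by rewrite linearZ.
Qed.

Lemma fg_prod M N : fin_gen M -> fin_gen N -> fin_gen (M * N)%type.
Proof.
move=> [n [s sP]] [k [t tP]].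
apply: (@fin_genT _ ('I_n + 'I_k)%type
  (fun z => match z with inl i => (s i, 0) | inr j => (0, t j) end)) => -[x y].
have [c xE] := sP x; have [d yE] := tP y.
exists (fun z => match z with inl i => c i | inr j => d j end).
rewrite big_sumType /=.
pose f := lpair (lid M) (lzero M N); pose g := lpair (lzero N M) (lid N).
have -> : (x, y) = f x + g y by apply/eqP; rewrite /eq_op /= addr0 add0r !eqxx.
rewrite {1}xE {1}yE !linear_sum; congr (_ + _); apply: eq_bigr => i _; exact: linearZ.
Qed.

Lemma fg_cover M : fin_gen M ->
  exists k (f : {linear {ffun 'I_k -> R^o} -> M}), surj f.
Proof.
move=> [n [s sP]]; exists n, (fcomb s) => y; have [c ->] := sP y.
by exists [ffun i => c i]; apply: eq_bigr => i _; rewrite ffunE.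
Qed.

Lemma proj_retract X Z : retract X Z -> projective Z -> projective X.
Proof.
move=> [s [r rs]] pZ U V fU fV g f gs.
have [h hP] := pZ U V fU fV g (lcomp f r) gs.
by exists (lcomp h s) => x /=; rewrite hP /= rs.
Qed.

Lemma proj_pow k X : projective X -> projective {ffun 'I_k -> X}.
Proof.
move=> pX U V fU fV g f gs.
have /choice [h hP] : forall i : 'I_k, exists h : {linear X -> U},
    forall x, g (h x) = f (finj i x).
  by move=> i; exact: (pX U V fU fV g (lcomp f (finj i)) gs).
exists (fsum h) => x; rewrite (fsum_proj f) /= linear_sum.
by apply: eq_bigr => i _; rewrite hP.
Qed.

Lemma proj_regular : projective R^o.
Proof.
move=> U V fU fV g f gs; have [u uP] := gs (f 1).
exists (lscal u) => a /=; rewrite linearZ /= uP -linearZ.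
by congr (f _); rewrite /GRing.scale /= mulr1.
Qed.

Lemma proj_prod X Y : projective X -> projective Y -> projective (X * Y)%type.
Proof.
move=> pX pY U V fU fV g f gs.
have [h hP] := pX U V fU fV g (lcomp f (lpair (lid X) (lzero X Y))) gs.
have [k kP] := pY U V fU fV g (lcomp f (lpair (lzero Y X) (lid Y))) gs.
exists (ladd (lcomp h (@lfst _ _ _)) (lcomp k (@lsnd _ _ _))) => -[x y] /=.
rewrite linearD /= hP kP /= -linearD; congr (f _).
by apply/eqP; rewrite /eq_op /= addr0 add0r !eqxx.
Qed.

Definition fgproj X := fin_gen X /\ projective X.

Lemma fgproj_free k : fgproj {ffun 'I_k -> R^o}.
Proof.
by split; [apply/fg_pow/fg_regular | apply/proj_pow/proj_regular].
Qed.

Lemma fgproj_retract X Z : retract X Z -> fgproj Z -> fgproj X.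
Proof. by move=> r [??]; split; [apply: fg_retract r _|apply: proj_retract r _]. Qed.

Lemma fgproj_prod X Y : fgproj X -> fgproj Y -> fgproj (X * Y)%type.
Proof. by move=> [??] [??]; split; [apply: fg_prod|apply: proj_prod]. Qed.

Lemma proj_split X Y (p : {linear Y -> X}) : fin_gen Y -> fin_gen X ->
  projective X -> surj p -> exists s : {linear X -> Y}, forall x, p (s x) = x.
Proof. by move=> fY fX pX ps; have [s] := pX Y X fY fX p (lid X) ps; exists s. Qed.

Lemma fgproj_in_free X : fgproj X -> exists k, retract X {ffun 'I_k -> R^o}.
Proof.
move=> [fX pX]; have [k [f fs]] := fg_cover fX; exists k.
by have [s sP] := proj_split (fgproj_free k).1 fX pX fs; exists s, f.
Qed.

Lemma inj_retract X Z : retract X Z -> injective_module Z -> injective_module X.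
Proof.
move=> [s [r rs]] pZ U V fU fV g f gi.
have [h hP] := pZ U V fU fV g (lcomp s f) gi.
by exists (lcomp r h) => x /=; rewrite hP /= rs.
Qed.

Lemma inj_pow k X : injective_module X -> injective_module {ffun 'I_k -> X}.
Proof.
move=> pX U V fU fV g f gi.
have /choice [h hP] : forall i : 'I_k, exists h : {linear V -> X},
    forall x, h (g x) = f x i.
  by move=> i; exact: (pX U V fU fV g (lcomp (fproj i) f) gi).
by exists (ftup h) => x; apply/ffunP => i; rewrite ffunE hP.
Qed.

Lemma inj_prod X Y : injective_module X -> injective_module Y ->
  injective_module (X * Y)%type.
Proof.
move=> pX pY U V fU fV g f gi.
have [h hP] := pX U V fU fV g (lcomp (@lfst _ _ _) f) gi.
have [k kP] := pY U V fU fV g (lcomp (@lsnd _ _ _) f) gi.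
by exists (lpair h k) => x /=; rewrite hP kP /= -surjective_pairing.
Qed.

Lemma retract_pow k X Z : retract X Z -> retract {ffun 'I_k -> X} {ffun 'I_k -> Z}.
Proof.
move=> [s [r rs]]; exists (ftup (fun i => lcomp s (fproj i))).
by exists (ftup (fun i => lcomp r (fproj i))) => x; apply/ffunP => i; rewrite !ffunE /= !ffunE.
Qed.

Lemma zero_fgproj X : zero_module X -> fgproj X.
Proof.
move=> X0; split.
  by exists 0%N, (fun _ => 0) => m; exists (fun _ => 0); rewrite (X0 m) big_ord0.
by move=> U V fU fV g f gs; exists (lzero _ _) => m; rewrite (X0 m) !linear0.
Qed.

(** The noetherian property in module form, a hypothesis of the homological part that [falg_noeth]
    supplies for algebras. *)
Definition noeth : Prop := forall X Y (f : {linear X -> Y}),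
  injective f -> fin_gen Y -> fin_gen X.

Hypothesis noe : noeth.

Lemma fg_sub Y (U : submod Y) : fin_gen Y -> fin_gen (smT U).
Proof. exact: (noe (@sm_incl_inj _ _ U)). Qed.

Lemma fg_quot Y (U : submod Y) : fin_gen Y -> fin_gen (quot U).
Proof. exact: fg_surj (@quot_pi_surj _ _ U). Qed.

Lemma fg_ses_l M N X (i : {linear M -> N}) (p : {linear N -> X}) :
  ses i p -> fin_gen N -> fin_gen M.
Proof. by case=> ii _ _; exact: noe ii. Qed.

Lemma fg_ses_r M N X (i : {linear M -> N}) (p : {linear N -> X}) :
  ses i p -> fin_gen N -> fin_gen X.
Proof. by case=> _ ps _; exact: fg_surj ps. Qed.

(** [projective] only tests surjections between finitely generated modules, so [d] is corestricted
    to the kernel of [e], which is finitely generated by the noetherian property. *)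
Lemma proj_lift P X Y Z (d : {linear X -> Y}) (e : {linear Y -> Z})
    (f : {linear P -> Y}) : fin_gen X -> fin_gen Y -> projective P ->
  exact_at d e -> (forall x, e (f x) = 0) ->
  exists h : {linear P -> X}, forall x, d (h x) = f x.
Proof.
move=> fX fY pP ex ef.
have [d' d'P] := @sm_factor _ _ (ker_sm e) _ d (fun x => proj2 (ex _) (ex_intro _ x erefl)).
have [f' f'P] := @sm_factor _ _ (ker_sm e) _ f ef.
have ds : surj d'.
  move=> y; have /ex [x xP] := sm_inclP y.
  by exists x; apply: sm_incl_inj; rewrite d'P.
have [h hP] := pP _ _ fX (fg_sub _ fY) d' f' ds.
by exists h => x; rewrite -d'P hP f'P.
Qed.

(** Dually, [f] factors through the image of [e], which embeds in [Z]. *)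
Lemma inj_ext Q X Y Z (d : {linear X -> Y}) (e : {linear Y -> Z})
    (f : {linear Y -> Q}) : fin_gen Y -> fin_gen Z -> injective_module Q ->
  exact_at d e -> (forall x, f (d x) = 0) ->
  exists h : {linear Z -> Q}, forall y, h (e y) = f y.
Proof.
move=> fY fZ iQ ex fd.
have [e' e'P] := @sm_factor _ _ (im_sm e) _ e (fun y => ex_intro _ y erefl).
have e's : surj e'.
  move=> z; have [y yP] := sm_inclP z.
  by exists y; apply: sm_incl_inj; rewrite e'P.
have [f' f'P] : exists g : {linear smT (im_sm e) -> Q}, forall y, g (e' y) = f y.
  apply: factor_surj => // y e'y.
  by have /ex [x <-] : e y = 0 by rewrite -e'P e'y linear0.
have [h hP] := iQ _ _ (fg_sub _ fZ) fZ _ f' (@sm_incl_inj _ _ _).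
by exists h => y; rewrite -e'P hP f'P.
Qed.

End Basics.

(** * Chain conditions *)

Lemma ex_max_nat (T : Type) (P : T -> Prop) (nu : T -> nat) (b : nat) :
  (exists x, P x) -> (forall x, P x -> (nu x <= b)%N) ->
  exists2 x, P x & forall y, P y -> (nu y <= nu x)%N.
Proof.
move=> [x0 Px0] Hb.
pose Q n := `[< exists2 x, P x & nu x = n >].
have exQ : exists n, Q n by exists (nu x0); apply/asboolP; exists x0.
have leQ n : Q n -> (n <= b)%N by move=> /asboolP [x Px <-]; exact: Hb.
case: (ex_maxnP exQ leQ) => n /asboolP [x Px nx] nmax.
by exists x => // y Py; rewrite nx; apply: nmax; apply/asboolP; exists y.
Qed.

Section VectorSpaces.
Variable K : fieldType.

(** A subspace of maximal dimension inside [U] contains every vector of [U], since adding a line of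
    [U] cannot raise the dimension. *)
Lemma submod_vspace (V : vectType K) (U : submod V) :
  exists W : {vspace V}, forall x, x \in W <-> U x.
Proof.
have [|W|W WU Wmax] := @ex_max_nat {vspace V} (fun W => forall x, x \in W -> U x)
  (fun W => \dim W) (\dim {: V}).
- by exists 0%VS => x; rewrite memv0 => /eqP ->; exact: sm0.
- by move=> _; rewrite dimvS ?subvf.
exists W => x; split=> [/WU//|Ux].
have /Wmax H : forall y, y \in (W + <[x]>)%VS -> U y.
  move=> y /memv_addP [w Ww [z /vlineP [k ->] ->]].
  by apply: smD; [exact: WU | exact: smZ].
have : (W == W + <[x]>)%VS by rewrite eqEdim addvSl.
by move/eqP ->; apply: subvP (addvSr _ _) _ (memv_line x).
Qed.

(** A generating family of minimal size is a basis. *)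
Lemma fin_gen_coord (N : lmodType K) : fin_gen N ->
  exists m (c : {linear N -> 'cV[K]_m}), bijective c.
Proof.
move=> fN.
pose spans m := `[< exists e : 'I_m -> N, forall x, exists c : 'I_m -> K,
   x = \sum_i c i *: e i >].
have exs : exists m, spans m by have [m H] := fN; exists m; apply/asboolP.
case: (ex_minnP exs) => m /asboolP [e eP] mmin.
(* In a relation with [c i] nonzero, the generator [e i] can be eliminated, against minimality. *)
have uniq0 (c : 'I_m -> K) : \sum_i c i *: e i = 0 -> forall i, c i = 0.
  move=> c0 i; apply: contrapT => /eqP ci.
  case: m e eP mmin c c0 i ci => [|m] e eP mmin c c0 i ci; first by case: i ci.
  suff /mmin : spans m by rewrite ltnn.
  apply/asboolP; exists (fun j => e (lift i j)) => x.
  have [d xE] := eP x; exists (fun j => d (lift i j) - d i / c i * c (lift i j)).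
  rewrite (_ : x = x - (d i / c i) *: \sum_i c i *: e i); last first.
    by rewrite c0 scaler0 subr0.
  rewrite {1}xE scaler_sumr -sumrB (bigD1_ord i) //= scalerA divfK // subrr add0r.
  by apply: eq_bigr => j _; rewrite scalerBl scalerA.
have [c cP] := choice eP.
have cl : linear (fun x => \col_i c x i : 'cV[K]_m).
  move=> a x y; apply/matrixP => i j; rewrite !mxE; apply/eqP; rewrite -subr_eq0.
  apply/eqP/(uniq0 (fun i => c (a *: x + y) i - (a * c x i + c y i))).
  under eq_bigr do rewrite scalerBl scalerDl -scalerA.
  by rewrite sumrB big_split -scaler_sumr /= -!cP subrr.
exists m, (lin cl); apply: inj_surj_bij.
  apply: lin_inj => x /= /matrixP E; rewrite (cP x) big1 // => i _.
  by have := E i 0; rewrite !mxE => ->; rewrite scale0r.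
move=> v; exists (\sum_i v i 0 *: e i); apply/matrixP => i j; rewrite !mxE ord1.
apply/eqP; rewrite -subr_eq0.
apply/eqP/(uniq0 (fun i => c (\sum_i v i 0 *: e i) i - v i 0)).
by under eq_bigr do rewrite scalerBl; rewrite sumrB -cP subrr.
Qed.

Lemma field_length (N : lmodType K) : fin_gen N ->
  exists (nu : submod N -> nat) (b : nat), (forall U, (nu U <= b)%N) /\
    forall U V : submod N, (forall x, U x -> V x) ->
      (nu U <= nu V)%N /\ (nu U = nu V -> forall x, V x -> U x).
Proof.
move=> /fin_gen_coord [m [c cb]].
have /choice [W WP] : forall U : submod N, exists W : {vspace 'cV[K]_m},
    forall x, c x \in W <-> U x.
  move=> U; have sU : is_submodule (fun v => exists2 x, U x & c x = v).
    split=> [|a _ _ [x Ux <-] [y Uy <-]].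
      by exists 0; [exact: sm0 | rewrite linear0].
    by exists (a *: x + y); [apply: smD => //; exact: smZ | rewrite linZD].
  have [W WP] := submod_vspace (Submod sU); exists W => x; split.
    by move/WP => /= [y Uy /(bij_inj cb) <-].
  by move=> Ux; apply/WP; exists x.
have [d cK dK] := cb.
exists (fun U => \dim (W U)), (\dim {: 'cV[K]_m}); split=> [U|U V UV].
  by rewrite dimvS ?subvf.
have sUV : (W U <= W V)%VS.
  by apply/subvP => v; rewrite -(dK v) => /WP Ux; apply/WP/UV.
split; first exact: dimvS.
move=> E x /WP Vx; apply/WP.
have /eqP -> // : (W U == W V)%VS by rewrite eqEdim sUV E leqnn.
Qed.
End VectorSpaces.

(** * Restriction of scalars to the ground field *)

Section Restriction.
Variables (K : fieldType) (A : falgType K) (M : lmodType A).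

(** An alias of [M] for the action of [K] through [A], kept apart from the action of [A]. *)
Definition kmod : Type := M.
HB.instance Definition _ := GRing.Zmodule.on kmod.
Let kscale (k : K) (x : kmod) : kmod := (k%:A : A) *: (x : M).
Fact kscaleA a b v : kscale a (kscale b v) = kscale (a * b) v.
Proof. by rewrite /kscale scalerA -scalerAl mul1r scalerA. Qed.
Fact kscale1 : left_id 1 kscale.
Proof. by move=> v; rewrite /kscale !scale1r. Qed.
Fact kscaleDr : right_distributive kscale +%R.
Proof. by move=> a x y; exact: (scalerDr (a%:A : A) (x : M) y). Qed.
Fact kscaleDl v : {morph kscale^~ v : a b / a + b}.
Proof. by move=> a b; rewrite /kscale scalerDl [LHS]scalerDl. Qed.
HB.instance Definition _ := GRing.Zmodule_isLmodule.Build K kmod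
  kscaleA kscale1 kscaleDr kscaleDl.

Lemma kmodZ (k : K) (x : kmod) : k *: x = (k%:A : A) *: (x : M).
Proof. by []. Qed.

Lemma kmod_scaleAl (k : K) (a : A) (x : kmod) :
  (k *: a) *: (x : M) = (k *: (a *: (x : M) : kmod) : kmod).
Proof. by rewrite kmodZ scalerA -scalerAl mul1r. Qed.

Lemma kmod_scaleC (k : K) (a : A) (x : kmod) :
  a *: ((k *: x : kmod) : M) = (k *: (a *: (x : M) : kmod) : kmod).
Proof. by rewrite -kmod_scaleAl kmodZ scalerA -scalerAr mulr1. Qed.

Lemma kmod_fg : fin_gen M -> fin_gen kmod.
Proof.
move=> [n [s sP]]; pose b := vbasis {: A}.
apply: (@fin_genT K kmod ('I_n * 'I_(\dim {: A}))%type
   (fun p => (b`_p.2 *: s p.1 : M))) => m.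
have [c mE] := sP m; exists (fun p => coord b p.2 (c p.1)).
rewrite -(pair_bigA _ (fun i j => coord b j (c i) *: (b`_j *: s i : kmod))) /=.
rewrite [LHS]mE; apply: eq_bigr => i _.
rewrite [in LHS](coord_vbasis (memvf (c i))) scaler_suml; apply: eq_bigr => j _.
by rewrite kmodZ scalerA -scalerAl mul1r.
Qed.

Fact kmod_sub_subproof (U : submod M) : @is_submodule K kmod U.
Proof. by split; [exact: sm0 | move=> k x y Ux Uy; apply: smD => //; apply: smZ]. Qed.
Definition kmod_sub (U : submod M) := Submod (kmod_sub_subproof U).

Lemma alg_length : fin_gen M ->
  exists (nu : submod M -> nat) (b : nat), (forall U, (nu U <= b)%N) /\
    forall U V : submod M, (forall x, U x -> V x) ->
      (nu U <= nu V)%N /\ (nu U = nu V -> forall x, V x -> U x).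
Proof.
move=> /kmod_fg /field_length [nu [b [nub nuP]]].
exists (fun U => nu (kmod_sub U)), b; split=> // U V UV.
exact: (nuP (kmod_sub U) (kmod_sub V)).
Qed.
End Restriction.

Section Chains.
Variables (K : fieldType) (A : falgType K).
Implicit Types M X Y : lmodType A.

Lemma max_submod M (P : submod M -> Prop) : fin_gen M -> (exists U, P U) ->
  exists2 U, P U & forall V, P V -> (forall x, U x -> V x) -> forall x, V x -> U x.
Proof.
move=> /alg_length [nu [b [nub nuP]]] /ex_max_nat /(_ (fun U _ => nub U)) [U PU Um].
exists U => // V PV UV; have [le eq] := nuP _ _ UV.
by apply: eq; apply/eqP; rewrite eqn_leq le Um.
Qed.

Lemma min_submod M (P : submod M -> Prop) : fin_gen M -> (exists U, P U) ->
  exists2 U, P U & forall V, P V -> (forall x, V x -> U x) -> forall x, U x -> V x.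
Proof.
move=> /alg_length [nu [b [nub nuP]]] /(@ex_max_nat _ _ (fun U => b - nu U)%N b).
move=> /(_ (fun U _ => leq_subr _ _)) [U PU Um].
exists U => // V PV VU; have [le eq] := nuP _ _ VU.
apply: eq; apply/eqP; rewrite eqn_leq le /=; have := Um V PV.
by rewrite leq_sub2lE // nub.
Qed.

(** Among the images under [f] of finitely generated submodules of [X], take a maximal one; adding
    any generator [x] leaves it unchanged, so it is the image of all of [X]. *)
Lemma falg_noeth : noeth A.
Proof.
move=> X Y f fi fY.
have [_ [k [g ->]] Umax] := @max_submod Y
  (fun U => exists k (g : {linear {ffun 'I_k -> A^o} -> X}), U = im_sm (lcomp f g)) fY
  (ex_intro _ _ (ex_intro _ 0%N (ex_intro _ (lzero _ _) erefl))).
apply: (@fg_surj _ _ _ g _ (fgproj_free _ _).1) => x.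
(* [h] is [g] with the extra generator [x], placed at index 0. *)
pose h := fcomb (fun i => if unlift (@ord0 k) i is Some j then g (finj j 1) else x).
have hg y : exists z, h z = g y.
  exists [ffun i => if unlift ord0 i is Some j then y j else 0].
  rewrite /= big_ord_recl unlift_none ffunE unlift_none scale0r add0r (fsum_proj g) /=.
  apply: eq_bigr => j _; rewrite ffunE liftK -linearZ; congr (g _).
  apply/ffunP => i; rewrite !ffunE; case: eqP => _; rewrite ?scaler0 //.
  by rewrite /GRing.scale /= mulr1.
have [|||z] := Umax (im_sm (lcomp f h)) _ _ (f x).
- by exists k.+1, h.
- by move=> _ [y <-] /=; have [z zE] := hg y; exists z; rewrite -zE.
- exists (finj ord0 1); rewrite /= (_ : \sum_i _ = h (finj ord0 1)) //.
  by rewrite fsum_finj /= unlift_none scale1r.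
by move=> /fi <-; exists z.
Qed.

End Chains.

(** * Syzygies and extensions *)

Section Homological.
Variable R : nzRingType.
Implicit Types M N X Y Z P Q C U V : lmodType R.
Hypothesis noe : noeth R.

(* [U] is a direct summand of [V] in the stable category. *)
Definition stab U V : Prop :=
  exists P (a : {linear U -> V}) (b : {linear V -> U})
    (s : {linear P -> U}) (r : {linear U -> P}),
    fgproj P /\ forall x, x - b (a x) = s (r x).

Lemma stab_retract X Z : retract X Z -> stab X Z.
Proof.
move=> [s [r rs]]; exists {ffun 'I_0 -> R^o}, s, r, (lzero _ _), (lzero _ _).
by split=> [|x]; [exact: fgproj_free | rewrite rs subrr].
Qed.

(** [U] is a retract of the direct sum of [V] and a projective module. *)
Lemma stab_proj U V : stab U V -> projective V -> projective U.
Proof.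
move=> [P [a [b [s [r [[fP pP] E]]]]]] pV.
apply: (@proj_retract _ _ (V * P)%type); last exact: proj_prod.
exists (lpair a r), (ladd (lcomp b (@lfst _ _ _)) (lcomp s (@lsnd _ _ _))) => x /=.
by rewrite -E addrC subrK.
Qed.

(* Schanuel's lemma *)
Lemma stab_ses U U1 P V V1 Q (i : {linear U1 -> P}) (p : {linear P -> U})
    (j : {linear V1 -> Q}) (q : {linear Q -> V}) :
  stab U V -> ses i p -> fgproj P -> ses j q -> fgproj Q ->
  exists (a1 : {linear U1 -> V1}) (b1 : {linear V1 -> U1})
         (a : {linear P -> Q}) (t : {linear P -> U1}),
    (forall x, j (a1 x) = a (i x)) /\ (forall x, x - b1 (a1 x) = t (i x)).
Proof.
move=> [T [a [b [s [r [[fT pT] E]]]]]] sP [fP pP] sQ [fQ pQ].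
have [ii ps ipx] := sP; have [ji qs jqx] := sQ.
have fU := fg_ses_r sP fP; have fV := fg_ses_r sQ fQ.
have [a' a'P] := pP _ _ fQ fV q (lcomp a p) qs.
have [b' b'P] := pQ _ _ fP fU p (lcomp b q) ps.
have [s' s'P] := pT _ _ fP fU p s ps.
have pi x : p (i x) = 0 by apply/ipx; exists x.
have qj x : q (j x) = 0 by apply/jqx; exists x.
have [a1 a1P] : exists g : {linear U1 -> V1}, forall x, j (g x) = lcomp a' i x.
  by apply: factor_inj => // x; apply/jqx; rewrite /= a'P /= pi linear0.
have [b1 b1P] : exists g : {linear V1 -> U1}, forall x, i (g x) = lcomp b' j x.
  by apply: factor_inj => // x; apply/ipx; rewrite /= b'P /= qj linear0.
(* [p] kills the values of [w] by the stable identity [E], so [w] factors through the kernel [U1] of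
   [p]. *)
pose w := lsub (lsub (lid P) (lcomp b' a')) (lcomp s' (lcomp r p)).
have [t tP] : exists g : {linear P -> U1}, forall x, i (g x) = w x.
  apply: factor_inj => // x; apply/ipx.
  by rewrite /= 2!linearB /= s'P b'P /= a'P /= E subrr.
exists a1, b1, a', t; split=> // x; apply: ii.
by rewrite tP linearB b1P /= a1P /= pi !linear0 addr0.
Qed.

(* [Phi] holds for some, respectively for every, [m]-th syzygy of [C]. *)
Fixpoint exS (Phi : lmodType R -> Prop) (m : nat) C : Prop :=
  if m is m'.+1 then exists P C1 (i : {linear C1 -> P}) (p : {linear P -> C}),
    [/\ fgproj P, ses i p & exS Phi m' C1] else Phi C.

Fixpoint alS (Phi : lmodType R -> Prop) (m : nat) C : Prop :=
  if m is m'.+1 then forall P C1 (i : {linear C1 -> P}) (p : {linear P -> C}),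
    fgproj P -> ses i p -> alS Phi m' C1 else Phi C.

(** Schanuel's lemma carries the stable summand relation to syzygies, whatever the chosen
    presentations; so what holds along one chain of syzygies of [V] passes to every chain of
    syzygies of [U]. *)
Lemma exS_alS (Phi Psi : lmodType R -> Prop) m U V :
  (forall U V, stab U V -> Phi V -> Psi U) ->
  stab U V -> exS Phi m V -> alS Psi m U.
Proof.
move=> PP; elim: m U V => [|m IH] U V /= UV; first exact: PP.
move=> [Q [V1 [j [q [fQ sQ eV1]]]]] P U1 i p fP sP.
have [a1 [b1 [a [t [_ E]]]]] := stab_ses UV sP fP sQ fQ.
apply: IH eV1; exists P, a1, b1, t, i; split=> //.
Qed.

(** Vanishing of Ext^1(C, M), tested on one projective presentation; [ext1] tests it on all of
    them. *)
Definition ext1e M C : Prop :=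
  exists P C1 (i : {linear C1 -> P}) (p : {linear P -> C}),
    [/\ fgproj P, ses i p & forall f : {linear C1 -> M},
        exists g : {linear P -> M}, forall x, g (i x) = f x].

Definition ext1 M C : Prop :=
  forall P C1 (i : {linear C1 -> P}) (p : {linear P -> C}),
    fgproj P -> ses i p -> forall f : {linear C1 -> M},
        exists g : {linear P -> M}, forall x, g (i x) = f x.

(** By Schanuel, [f] is the sum of [f b1 a1] and [f t i]. The first extends because [f b1] extends
    to [Q]; the second is already defined on [P]. *)
Lemma stab_ext1 M U V : stab U V -> ext1e M V -> ext1 M U.
Proof.
move=> UV [Q [V1 [j [q [fQ sQ eV1]]]]] P U1 i p fP sP f.
have [a1 [b1 [a [t [ja E]]]]] := stab_ses UV sP fP sQ fQ.
have [h hP] := eV1 (lcomp f b1).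
exists (ladd (lcomp h a) (lcomp f t)) => x /=.
by rewrite -E -ja hP /= linearB addrC subrK.
Qed.

Lemma exS_ext1_pow k M m C : exS (ext1e M) m C -> exS (ext1e M) m {ffun 'I_k -> C}.
Proof.
have pow_ses X P Y (i : {linear X -> P}) (p : {linear P -> Y}) : ses i p ->
    ses (ftup (fun j : 'I_k => lcomp i (fproj j)))
        (ftup (fun j : 'I_k => lcomp p (fproj j))).
  move=> [ii ps ex]; split.
  - by move=> x y /ffunP E; apply/ffunP => j; apply: ii; have := E j; rewrite !ffunE.
  - move=> y; have [x xP] := choice (fun j => ps (y j)).
    by exists [ffun j => x j]; apply/ffunP => j; rewrite !ffunE /= ffunE.
  - move=> y; split=> [/ffunP E|[x <-]]; last first.
      by apply/ffunP => j; rewrite !ffunE /= ffunE; apply/ex; exists (x j).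
    have /choice [x xP] : forall j, exists x, i x = y j.
      by move=> j; apply/ex; have := E j; rewrite !ffunE.
    by exists [ffun j => x j]; apply/ffunP => j; rewrite !ffunE /= ffunE.
have pow_fp P : fgproj P -> fgproj {ffun 'I_k -> P}.
  by case=> fP pP; split; [exact: fg_pow | exact: proj_pow].
elim: m C => [|m IH] C /= [P [C1 [i [p [fP sP H]]]]];
  (do 4!eexists); (split; [exact: pow_fp fP | exact: pow_ses sP | ]).
  move=> f.
  have /choice [g gP] : forall j, exists g : {linear P -> M},
    forall x, g (i x) = f (finj j x) by move=> j; exact: (H (lcomp f (finj j))).
  exists (fsum g) => x; rewrite (fsum_proj f) /=; apply: eq_bigr => j _.
  by rewrite ffunE gP.
exact: IH.
Qed.

Section Truncation.
Variables (X : lmodType R) (P : proj_resolution X).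
Let C := smT (ker_sm (pres_aug P)).

Fact trunc_aug_ex : exists g : {linear pres_obj P 1 -> C},
  forall x, sm_incl (ker_sm (pres_aug P)) (g x) = pres_d P 0 x.
Proof. by apply: (@sm_factor _ _ (ker_sm _)) => x; apply/(@pres_exact0 _ _ P); exists x. Qed.
Definition trunc_aug := projT1 (cid trunc_aug_ex).
Lemma trunc_augP x : sm_incl (ker_sm (pres_aug P)) (trunc_aug x) = pres_d P 0 x.
Proof. exact: (projT2 (cid trunc_aug_ex)). Qed.

Fact trunc_surj : surj trunc_aug.
Proof.
move=> y; have [x xP] := proj1 (@pres_exact0 _ _ P _) (sm_inclP y).
by exists x; apply: sm_incl_inj; rewrite trunc_augP.
Qed.
Fact trunc_exact0 : exact_at (pres_d P 1) trunc_aug.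
Proof.
move=> y; split=> [H|[x <-]].
  by apply/(@pres_exact _ _ P 0); rewrite -trunc_augP H linear0.
by apply: sm_incl_inj; rewrite trunc_augP linear0; apply/(@pres_exact _ _ P 0); exists x.
Qed.

(** Dropping the term of degree 0 leaves a resolution of the first syzygy, which is the device for
    dimension shifting. *)
Definition truncation : proj_resolution C :=
  @ProjResolution R C (fun i => pres_obj P i.+1) (fun i => pres_d P i.+1) trunc_aug
    (fun i => @pres_fg _ _ P i.+1) (fun i => @pres_proj _ _ P i.+1) trunc_surj trunc_exact0
    (fun i => @pres_exact _ _ P i.+1).

Lemma aug_ses : ses (sm_incl (ker_sm (pres_aug P))) (pres_aug P).
Proof. exact/ker_ses/(@pres_aug_surj _ _ P). Qed.

Lemma pres_fgproj i : fgproj (pres_obj P i).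
Proof. by split; [exact: pres_fg | exact: pres_proj]. Qed.
End Truncation.

(** Truncation lowers the bound by one; at bound 0 the augmentation is an isomorphism. *)
Lemma pdim_le_exS C m : pdim_le C m -> exS (@projective R) m C.
Proof.
elim: m C => [|m IH] C [P Pz] /=.
  apply: proj_retract (@pres_proj _ _ P 0%N); apply: (@proj1 _ (retract (pres_obj P 0) C)).
  rewrite and_comm; apply: (@retract_iso _ _ _ (pres_aug P)).
  apply: inj_surj_bij; last exact: (@pres_aug_surj _ _ P).
  by apply: lin_inj => x /(@pres_exact0 _ _ P) [y <-]; rewrite (Pz 1%N isT y) linear0.
exists (pres_obj P 0), (smT (ker_sm (pres_aug P))), (sm_incl _), (pres_aug P).
split; [exact: pres_fgproj | exact: aug_ses | apply: IH; exists (truncation P)].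
by move=> i mi; exact: (Pz i.+1).
Qed.

Lemma pdim_le_alS C m : pdim_le C m -> alS (@projective R) m C.
Proof.
move=> /pdim_le_exS; apply: exS_alS; first exact: stab_proj.
exact/stab_retract/retract_refl.
Qed.

(** Dimension shifting: Ext^(m+1) of [X] is Ext^1 of its [m]-th syzygy. *)
Lemma alS_Ext_zero M X m : alS (ext1 M) m X -> Ext_zero m.+1 X M.
Proof.
elim: m X => [|m IH] X H P f fc; last first.
  have /= H' := H _ _ _ _ (pres_fgproj P 0) (aug_ses P).
  exact: (IH _ H' (truncation P) f fc).
have [f' f'P] : exists g : {linear smT (ker_sm (pres_aug P)) -> M},
    forall x, g (trunc_aug P x) = f x.
  apply: factor_surj; first exact: trunc_surj.
  by move=> x /(@trunc_exact0 _ P _) [y <-]; exact: fc.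
have [g gP] := H _ _ _ _ (pres_fgproj P 0) (aug_ses P) f'.
by exists g => x; rewrite -f'P -gP trunc_augP.
Qed.

Record fgmod := FgMod { fgm_mod : lmodType R; fgm_fg : fin_gen fgm_mod }.

Lemma fg_resolution X : fin_gen X -> inhabited (proj_resolution X).
Proof.
move=> fX.
(* Fixing one free cover for each module lets the syzygies be defined by iteration. *)
pose kc (Y : fgmod) :
    {k : nat & {c : {linear {ffun 'I_k -> R^o} -> fgm_mod Y} | surj c}} :=
  let H := cid (fg_cover (fgm_fg Y)) in existT _ (projT1 H) (cid (projT2 H)).
pose F (Y : fgmod) : lmodType R := {ffun 'I_(projT1 (kc Y)) -> R^o}.
pose c (Y : fgmod) : {linear F Y -> fgm_mod Y} := sval (projT2 (kc Y)).
have cs (Y : fgmod) : surj (c Y) := svalP (projT2 (kc Y)).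
have fF (Y : fgmod) : fgproj (F Y) by exact: fgproj_free.
pose syz (Y : fgmod) := FgMod (fg_sub noe (ker_sm (c Y)) (fF Y).1).
pose S j := iter j syz (FgMod fX).
pose d j : {linear F (S j.+1) -> F (S j)} := lcomp (sm_incl (ker_sm (c (S j)))) (c (S j.+1)).
have dE j y : (exists x, d j x = y) <-> c (S j) y = 0.
  split=> [[x <-]|]; first exact: (sm_inclP (c (S j.+1) x)).
  move/(@sm_incl_ex _ _ (ker_sm _)) => [z <-].
  by have [x <-] := cs (S j.+1) z; exists x.
have ex j : exact_at (d j.+1) (d j).
  move=> y; rewrite dE; split=> [H|H]; last by rewrite /= H.
  by apply: (@sm_incl_inj _ _ (ker_sm (c (S j)))); rewrite linear0.
have ex0 : exact_at (d 0%N) (c (S 0%N)) by move=> y; rewrite dE.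
by constructor; exact: (@ProjResolution R X (fun j => F (S j)) d (c (S 0%N))
  (fun j => (fF (S j)).1) (fun j => (fF (S j)).2) (cs (S 0%N)) ex0 ex).
Qed.

(** [Y] is a second syzygy of the cokernel of [d]. *)
Lemma alS_second_syzygy (Phi : lmodType R -> Prop) m Y (J J' : lmodType R)
    (i : {linear Y -> J}) (d : {linear J -> J'}) :
  injective i -> exact_at i d -> fgproj J -> fgproj J' ->
  alS Phi m.+2 (quot (im_sm d)) -> alS Phi m Y.
Proof.
move=> ii ex fJ fJ' H.
have sJ' : ses (sm_incl (im_sm d)) (quot_pi (im_sm d)).
  split; [exact: sm_incl_inj | exact: quot_pi_surj | ].
  move=> y; rewrite quot_pi0; split=> [|[x <-]]; first exact: (@sm_incl_ex _ _ (im_sm d)).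
  exact: sm_inclP.
have [d' d'P] := @sm_factor _ _ (im_sm d) _ d (fun y => ex_intro _ y erefl).
apply: (H _ _ _ _ fJ' sJ' J Y i d' fJ); split=> //.
  move=> z; have [y yP] := sm_inclP z.
  by exists y; apply: sm_incl_inj; rewrite d'P.
move=> y; rewrite -ex -d'P; split=> [->|E]; first by rewrite linear0.
by apply: (@sm_incl_inj _ _ (im_sm d)); rewrite E linear0.
Qed.

(** * Detecting projectivity through an injective coresolution of the ring *)

Section Balance.
Variables (J : nat -> lmodType R) (d : forall k, {linear J k -> J k.+1})
  (eps : {linear R^o -> J 0%N}).
Hypotheses (fJ : forall k, fin_gen (J k)) (iJ : forall k, injective_module (J k)).
Hypotheses (dd : forall k x, d k.+1 (d k x) = 0) (eps_inj : injective eps)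
  (eps_exact : exact_at eps (d 0%N)).

(* As [J] is an injective coresolution of [R^o], this says Ext^(k+1)(Y, R) = 0. *)
Definition liftable Y (k : nat) : Prop :=
  forall phi : {linear Y -> J k.+1}, (forall y, d k.+1 (phi y) = 0) ->
  exists om : {linear Y -> J k}, forall y, d k (om y) = phi y.

(** Extend [phi] to [P] by injectivity. Composed with [d k], the extension vanishes on [Y1] and
    descends to a cocycle on [Y]; subtracting a lift of that cocycle turns the extension into a
    cocycle. *)
Lemma liftable_shift Y Y1 P (i : {linear Y1 -> P}) (p : {linear P -> Y}) k
    (phi : {linear Y1 -> J k}) : fgproj P -> ses i p -> liftable Y k ->
  (forall y, d k (phi y) = 0) ->
  exists f : {linear P -> J k}, (forall y, d k (f y) = 0) /\ forall y, f (i y) = phi y.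
Proof.
move=> fP sP HY dphi; have [ii ps ex] := sP.
have [f fE] := iJ (fg_ses_l noe sP fP.1) fP.1 phi ii.
have pi x : p (i x) = 0 by apply/ex; exists x.
have [chi chiE] : exists g : {linear Y -> J k.+1}, forall x, g (p x) = lcomp (d k) f x.
  by apply: factor_surj => // x /ex [y <-]; rewrite /= fE dphi.
have [|om omE] := HY chi.
  by move=> y; have [x <-] := ps y; rewrite chiE /= dd.
exists (lsub f (lcomp om p)); split=> y /=.
  by rewrite linearB /= omE chiE /= subrr.
by rewrite pi linear0 subr0 fE.
Qed.

(* If Y has a syzygy Y1 that is projective, then Ext^1(Y, R) = 0 makes Y1 split
   off; the vanishing of Ext^k(Y, R) passes to Y1 with [k] lowered by one. *)
Lemma balance m Y : fin_gen Y -> alS (@projective R) m Y ->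
  (forall k, (k.+1 < m)%N -> exact_at (d k) (d k.+1)) ->
  (forall k, (k < m)%N -> liftable Y k) -> projective Y.
Proof.
elim: m Y => [//|m IH] Y fY aY exJ HY.
have [n [p ps]] := fg_cover fY.
pose P : lmodType R := {ffun 'I_n -> R^o}; rewrite -/P in p ps.
have fP : fgproj P by exact: fgproj_free.
set Y1 := smT (ker_sm p); set i := sm_incl (ker_sm p).
have sP : ses i p by exact: ker_ses.
have fY1 : fin_gen Y1 by exact: (fg_ses_l noe sP fP.1).
have [s [t [r rs]]] : exists k, retract Y1 {ffun 'I_k -> R^o}.
  apply: fgproj_in_free; split=> //; apply: IH => //.
  + exact: (aY _ _ _ _ fP sP).
  + by move=> k km; apply: exJ; rewrite ltnW.
  + move=> k km phi dphi.
    have [f [df fi]] := liftable_shift fP sP (HY k.+1 km) dphi.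
    have [h hE] := proj_lift noe (fJ k) (fJ k.+1) fP.2 (exJ k km) df.
    by exists (lcomp h i) => y; rewrite /= hE fi.
have ext (phi : {linear Y1 -> R^o}) : exists g : {linear P -> R^o}, forall y, g (i y) = phi y.
  have [|f [df fi]] := @liftable_shift _ _ _ _ _ 0%N (lcomp eps phi) fP sP (HY 0%N isT).
    by move=> y; apply/eps_exact; exists (phi y).
  have [g gE] : exists g : {linear P -> R^o}, forall x, eps (g x) = f x.
    by apply: factor_inj => // x; apply/eps_exact.
  by exists g => y; apply: eps_inj; rewrite gE fi.
have /choice [g gE] := fun j => ext (lcomp (fproj j) t).
(* The coordinates of [t] extend to [P]; followed by [r] they give a retraction of [i], so the
   sequence splits. *)
pose rho := lcomp r (ftup g).
have rhoi y : rho (i y) = y.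
  rewrite -[RHS]rs; congr (r _); apply/ffunP => j; rewrite ffunE gE //.
have [_ _ ex] := sP.
have [sg sgE] : exists h : {linear Y -> P}, forall x, h (p x) = lsub (lid P) (lcomp i rho) x.
  by apply: factor_surj => // x /ex [y <-]; change (i y - i (rho (i y)) = 0); rewrite rhoi subrr.
apply: proj_retract fP.2; exists sg, p => y; have [x <-] := ps y.
rewrite sgE; change (p (x - i (rho x)) = p x); rewrite linearB.
by rewrite (proj2 (ex _) (ex_intro _ (rho x) erefl)) subr0.
Qed.

End Balance.
End Homological.

(** * The duality defined by a bimodule *)

Lemma finj_regular (R : nzRingType) k (i : 'I_k) (a : R^o) :
  a *: (finj i 1 : {ffun 'I_k -> R^o}) = finj i a.
Proof.
apply/ffunP => j; rewrite !ffunE.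
by case: (j == i); rewrite ?scaler0 // /GRing.scale /= mulr1.
Qed.

Lemma retract_pow1 (R : nzRingType) (X : lmodType R) : retract X {ffun 'I_1 -> X}.
Proof. by exists (finj ord0), (fproj ord0) => x /=; rewrite ffunE. Qed.

Lemma in_add_refl (R : nzRingType) (X : lmodType R) : in_add X X.
Proof. by exists 1%N; exact/retract_summand/retract_pow1. Qed.

(* One abelian group with commuting left actions of two rings, presented as two
   modules with additive bijections between them. *)
Record bimod (R T : nzRingType) := Bimod {
  bm_l : lmodType R;
  bm_r : lmodType T;
  bm_lr : bm_l -> bm_r;
  bm_rl : bm_r -> bm_l;
  bm_lrK : cancel bm_lr bm_rl;
  bm_rlK : cancel bm_rl bm_lr;
  bm_lrD : forall x y, bm_lr (x + y) = bm_lr x + bm_lr y;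
  bm_comm : forall a t q,
    bm_rl (t *: bm_lr (a *: q)) = a *: bm_rl (t *: bm_lr q) }.
Arguments bm_lr {R T} b _.
Arguments bm_rl {R T} b _.
Arguments bm_lrK {R T} b _.
Arguments bm_rlK {R T} b _.
Arguments bm_lrD {R T} b _ _.
Arguments bm_comm {R T} b _ _ _.

Section Swap.
Variables (R T : nzRingType) (Q : bimod R T).

Lemma bm_rlD x y : bm_rl Q (x + y) = bm_rl Q x + bm_rl Q y.
Proof. by apply: (can_inj (bm_lrK Q)); rewrite bm_lrD !bm_rlK. Qed.

Fact bm_comm_swap t a q :
  bm_lr Q (a *: bm_rl Q (t *: q)) = t *: bm_lr Q (a *: bm_rl Q q).
Proof. by rewrite -{1}(bm_rlK Q q) -bm_comm bm_rlK. Qed.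

(** With the sides exchanged, the single construction [hom] yields both F = Hom_A(-, Q) and G =
    Hom_B(-, Q). *)
Definition swap : bimod T R :=
  Bimod (bm_rlK Q) (bm_lrK Q) bm_rlD bm_comm_swap.

Lemma bm_lr0 : bm_lr Q 0 = 0.
Proof. by apply: (addIr (bm_lr Q 0)); rewrite -bm_lrD !add0r. Qed.
Lemma bm_lr_sum I (r : seq I) (F : I -> bm_l Q) :
  bm_lr Q (\sum_(i <- r) F i) = \sum_(i <- r) bm_lr Q (F i).
Proof. exact: (big_morph _ (bm_lrD Q) bm_lr0). Qed.
Lemma bm_lr_eq0 x : bm_lr Q x = 0 -> x = 0.
Proof. by rewrite -bm_lr0; apply: (can_inj (bm_lrK Q)). Qed.
End Swap.
Arguments bm_rlD {R T} Q _ _.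
Arguments bm_comm_swap {R T} Q _ _ _.
Arguments bm_lr0 {R T} Q.
Arguments bm_lr_sum {R T} Q {I} r F.
Arguments bm_lr_eq0 {R T} Q x _.

(** * The contravariant functor of homomorphisms into a bimodule *)

Section HomModule.
Variables (R T : nzRingType) (Q : bimod R T).
Let Ql : lmodType R := bm_l Q.
Let Qr : lmodType T := bm_r Q.
Let w : Ql -> Qr := bm_lr Q.
Let w' : Qr -> Ql := bm_rl Q.

Section Def.
Variable X : lmodType R.

(** A function with a proof of linearity, so that pointwise equality gives equality; [T] will act on
    the values. *)
Definition hom : Type := {f : X -> Ql | linear f}.
HB.instance Definition _ := gen_eqMixin hom.
HB.instance Definition _ := gen_choiceMixin hom.

Definition happ (h : hom) : {linear X -> Ql} := lin (proj2_sig h).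
Definition hmk (f : {linear X -> Ql}) : hom :=
  @exist (X -> Ql) (fun g => linear g) f (fun a x y => linZD f a x y).

Lemma hom_ext (f g : hom) : (forall x, happ f x = happ g x) -> f = g.
Proof.
case: f g => [f fl] [g gl] /= E; have fg : f = g by apply: funext.
by case: g / fg gl E => gl _; congr exist; exact: Prop_irrelevance.
Qed.

Fact hact_subproof t (f : hom) : linear (fun x => w' (t *: w (happ f x))).
Proof.
by move=> a x y; rewrite linZD /w bm_lrD scalerDr /w' bm_rlD bm_comm.
Qed.

Let hadd (f g : hom) : hom := hmk (ladd (happ f) (happ g)).
Let hopp (f : hom) : hom := hmk (lsub (lzero _ _) (happ f)).
Let hzero : hom := hmk (lzero _ _).
Let hact t (f : hom) : hom := hmk (lin (hact_subproof t f)).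

Fact haddA : associative hadd.
Proof. by move=> f g h; apply: hom_ext => x /=; rewrite addrA. Qed.
Fact haddC : commutative hadd.
Proof. by move=> f g; apply: hom_ext => x /=; rewrite addrC. Qed.
Fact hadd0 : left_id hzero hadd.
Proof. by move=> f; apply: hom_ext => x /=; rewrite add0r. Qed.
Fact haddN : left_inverse hzero hopp hadd.
Proof. by move=> f; apply: hom_ext => x /=; rewrite sub0r addNr. Qed.
HB.instance Definition _ := GRing.isZmodule.Build hom haddA haddC hadd0 haddN.

Fact hactA a b (f : hom) : hact a (hact b f) = hact (a * b) f.
Proof. by apply: hom_ext => x /=; rewrite /w /w' bm_rlK scalerA. Qed.
Fact hact1 : left_id 1 hact.
Proof. by move=> f; apply: hom_ext => x /=; rewrite scale1r /w /w' bm_lrK. Qed.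
Fact hactDr : right_distributive hact +%R.
Proof.
by move=> a f g; apply: hom_ext => x /=; rewrite /w /w' bm_lrD scalerDr bm_rlD.
Qed.
Fact hactDl f : {morph hact^~ f : a b / a + b}.
Proof. by move=> a b; apply: hom_ext => x /=; rewrite scalerDl /w' bm_rlD. Qed.
HB.instance Definition _ := GRing.Zmodule_isLmodule.Build T hom
  hactA hact1 hactDr hactDl.

Lemma happ_mk f x : happ (hmk f) x = f x. Proof. by []. Qed.
Lemma happD f g x : happ (f + g) x = happ f x + happ g x. Proof. by []. Qed.
Lemma happ0 x : happ 0 x = 0. Proof. by []. Qed.
Lemma happZ t f x : happ (t *: f) x = w' (t *: w (happ f x)). Proof. by []. Qed.

Opaque happ.

Fact heval_subproof x : linear (fun f : hom => w (happ f x)).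
Proof. by move=> t f g; rewrite happD happZ /w bm_lrD bm_rlK. Qed.
Definition heval x : {linear hom -> Qr} := lin (heval_subproof x).
End Def.

Opaque happ.

Lemma hom_lin (X : lmodType R) (Z : lmodType T) (f : Z -> hom X) :
  (forall x, linear (fun z => w (happ (f z) x))) -> linear f.
Proof.
move=> H t y z; apply: hom_ext => x; apply: (can_inj (bm_lrK Q)).
by rewrite happD happZ bm_lrD bm_rlK; exact: (H x).
Qed.

Section Map.
Variables (X Y : lmodType R).
Fact hmap_subproof (d : {linear X -> Y}) :
  linear (fun f : hom Y => hmk (lcomp (happ f) d) : hom X).
Proof. by move=> t f g; apply: hom_ext. Qed.
Definition hmap (d : {linear X -> Y}) : {linear hom Y -> hom X} := lin (hmap_subproof d).
Lemma hmapE d f x : happ (hmap d f) x = happ f (d x). Proof. by []. Qed.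
End Map.

Lemma hmap_exact (X Y Z : lmodType R) (d : {linear X -> Y}) (p : {linear Y -> Z}) :
  surj p -> exact_at d p -> injective (hmap p) /\ exact_at (hmap p) (hmap d).
Proof.
move=> ps ex; split.
  by move=> f g E; apply: hom_ext => z; have [y <-] := ps z; rewrite -!hmapE E.
move=> g; split=> [g0|[f <-]]; last first.
  apply: hom_ext => x; rewrite !hmapE happ0.
  by rewrite (proj2 (ex _) (ex_intro _ x erefl)) linear0.
have [f fE] : exists f : {linear Z -> Ql}, forall x, f (p x) = happ g x.
  by apply: factor_surj => // y /ex [x <-]; rewrite -hmapE g0.
by exists (hmk f); apply: hom_ext => y; rewrite hmapE happ_mk fE.
Qed.

Lemma retract_hom (X Z : lmodType R) : retract X Z -> retract (hom X) (hom Z).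
Proof.
move=> [s [r rs]]; exists (hmap r), (hmap s) => f; apply: hom_ext => x.
by rewrite !hmapE rs.
Qed.

Lemma hom_free_retract k :
  retract (hom {ffun 'I_k -> R^o}) {ffun 'I_k -> Qr}.
Proof.
pose e i : {ffun 'I_k -> R^o} := finj i 1.
have hl : linear (fun q : {ffun 'I_k -> Qr} => hmk (fcomb (fun i => w' (q i))) :
    hom {ffun 'I_k -> R^o}).
  apply: hom_lin => x t y z; rewrite !happ_mk /= /w !bm_lr_sum.
  rewrite scaler_sumr -big_split; apply: eq_bigr => i _ /=.
  rewrite !ffunE /w'.
  by rewrite bm_rlD scalerDr bm_lrD (bm_comm_swap Q).
exists (ftup (fun i => heval (e i))), (lin hl) => f; apply: hom_ext => x; rewrite /= happ_mk /=.
under eq_bigr do rewrite ffunE /= /w /w' bm_lrK.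
rewrite [RHS](fsum_proj (happ f)) /=; apply: eq_bigr => i _.
by rewrite -linZ finj_regular.
Qed.

Lemma hom_fgproj_retract (P : lmodType R) : fgproj P ->
  exists k, retract (hom P) {ffun 'I_k -> Qr}.
Proof.
move=> /fgproj_in_free [k rP]; exists k.
exact: retract_trans (retract_hom rP) (hom_free_retract k).
Qed.

Lemma hom_fg (X : lmodType R) : noeth T -> fin_gen Qr -> fin_gen X -> fin_gen (hom X).
Proof.
move=> nT fQ /fg_cover [k [f fs]]; apply: (nT _ _ (hmap f)).
  by move=> g h E; apply: hom_ext => z; have [y <-] := fs z; rewrite -!hmapE E.
exact: fg_retract (hom_free_retract k) (fg_pow _ fQ).
Qed.

End HomModule.
Global Opaque happ.

Section RelativeDominantDimension.
Variables (R : nzRingType) (M : lmodType R).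

Definition summand_pow (J : lmodType R) : Prop :=
  exists k, retract J {ffun 'I_k -> M}.

Lemma summand_pow_retract J : retract J M -> summand_pow J.
Proof. by move=> r; exists 1%N; exact: retract_trans r (retract_pow1 _). Qed.

(* There is an exact sequence [0 -> Z -> J_1 -> ... -> J_m] with terms in
   [add M]. *)
Fixpoint domdim_ge m (Z : lmodType R) : Prop :=
  if m is m'.+1 then exists (J Z' : lmodType R) (i : {linear Z -> J}) (p : {linear J -> Z'}),
    [/\ ses i p, summand_pow J & domdim_ge m' Z'] else True.

Lemma domdim_ge_mono m m' Z : (m <= m')%N -> domdim_ge m' Z -> domdim_ge m Z.
Proof.
elim: m m' Z => [//|m IH] [//|m'] Z mm' [J [Z' [i [p [? ? H]]]]].
by exists J, Z', i, p; split=> //; exact: IH H.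
Qed.

End RelativeDominantDimension.

(** * Biduality with respect to Q between modules over A and B *)

Section Duality.
Variables (A B : nzRingType) (Q : bimod A B).
Local Notation QA := (bm_l Q).
Local Notation QB := (bm_r Q).
Local Notation u := (bm_lr Q).
Local Notation v := (bm_rl Q).
Local Notation F := (hom Q).
Local Notation G := (hom (swap Q)).
Local Notation addQ := (summand_pow QA).
Local Notation Gmk := (@hmk _ _ (swap Q) _).
Hypotheses (noeA : noeth A) (noeB : noeth B).
Hypotheses (QA_fgp : fgproj QA) (QA_inj : injective_module QA) (QB_fg : fin_gen QB).
(** Together with [faithB] this identifies [B] with the endomorphism ring of [QA]. *)
Hypothesis full : forall f : {linear QA -> QA},
  exists b : B, forall q, f q = v (b *: u q).
Hypothesis faithB : forall b : B, (forall m : QB, b *: m = 0) -> b = 0.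

Lemma G_eval_lin (X : lmodType B) x : linear (fun g : G X => v (happ g x)).
Proof. exact: (@heval_subproof _ _ (swap Q)). Qed.

Lemma G_fg X : fin_gen X -> fin_gen (G X).
Proof. exact: (hom_fg (Q := swap Q) noeA QA_fgp.1). Qed.

Lemma G_addQ P : fgproj P -> addQ (G P).
Proof. exact: (@hom_fgproj_retract _ _ (swap Q)). Qed.
Lemma addQ_fgproj J : addQ J -> fgproj J.
Proof.
move=> [k rJ]; apply: fgproj_retract rJ _; case: QA_fgp => fQ pQ.
by split; [exact: fg_pow | exact: proj_pow].
Qed.
Lemma addQ_inj J : addQ J -> injective_module J.
Proof. by move=> [k rJ]; apply: inj_retract rJ _; exact: inj_pow. Qed.

(** G(B^k) is Q^k, and by [full] a map from Q^k to Q is given by [k] elements of [B]. *)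
Lemma free_refl k (phi : {linear G {ffun 'I_k -> B^o} -> QA}) :
  exists p, forall g, phi g = v (happ g p).
Proof.
pose Bk : lmodType B := {ffun 'I_k -> B^o}.
pose e i : Bk := finj i 1.
(* This map includes Q as the [i]-th factor of G(B^k). *)
have hl i : linear (fun q : QA => Gmk (lcomp (lscal (u q)) (fproj i)) : G Bk).
  apply: (@hom_lin _ _ (swap Q)) => x a y z; rewrite !happ_mk /=.
  by rewrite bm_lrD scalerDr bm_rlD bm_comm.
have /choice [b bP] := fun i => full (lcomp phi (lin (hl i))).
exists [ffun i => b i] => g.
rewrite (fsum_proj (happ g)) /= -[v]/(bm_lr (swap Q)) bm_lr_sum /=.
transitivity (\sum_i phi (lin (hl i) (v (happ g (e i))))).
  rewrite -linear_sum; congr (phi _); apply: hom_ext => x.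
  have -> : happ (\sum_i lin (hl i) (v (happ g (e i)))) x =
            \sum_i happ (lin (hl i) (v (happ g (e i)))) x.
    by elim/big_rec2: _ => // i y f _ <-.
  rewrite (fsum_proj (happ g)) /=; apply: eq_bigr => i _.
  rewrite happ_mk /= bm_rlK; symmetry; etransitivity.
    exact: (esym (linZ (happ g) _ _)).
  by rewrite finj_regular.
apply: eq_bigr => i _; have /= -> := bP i (v (happ g (e i))).
rewrite bm_rlK; congr (v _).
etransitivity; first exact: (esym (linZ (happ g) _ _)).
by rewrite finj_regular /= ffunE.
Qed.

Lemma free_sep k (p : {ffun 'I_k -> B^o}) :
  (forall g : G {ffun 'I_k -> B^o}, happ g p = 0) -> p = 0.
Proof.
move=> H; apply/ffunP => i; rewrite ffunE; apply: faithB => m.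
exact: (H (Gmk (lcomp (lscal m) (fproj i)))).
Qed.

Lemma fg_presentation X : fin_gen X -> exists k l
  (d : {linear {ffun 'I_l -> B^o} -> {ffun 'I_k -> B^o}})
  (p : {linear {ffun 'I_k -> B^o} -> X}), surj p /\ exact_at d p.
Proof.
move=> /fg_cover [k [p ps]].
have [l [d ds]] := fg_cover (fg_sub noeB (ker_sm p) (fgproj_free B k).1).
exists k, l, (lcomp (sm_incl _) d), p; split=> // y.
rewrite (ker_exact p y); split=> [[z <-]|[z <-]]; last by exists (d z).
by have [x <-] := ds z; exists x.
Qed.

(** On a free presentation G is left exact and Hom_A(-, Q) is exact, as [QA] is injective. This
    reduces the biduality map of [X], here its injectivity and its surjectivity, to free modules. *)
Lemma fg_refl X : fin_gen X ->
  (forall x : X, (forall g : G X, happ g x = 0) -> x = 0) /\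
  (forall phi : {linear G X -> QA}, exists x, forall g, phi g = v (happ g x)).
Proof.
move=> fX; have [k [l [d [p [ps ex]]]]] := fg_presentation fX.
have [pi pex] := hmap_exact (swap Q) ps ex.
have fGk := G_fg (fgproj_free B k).1; have fGl := G_fg (fgproj_free B l).1.
split=> [x H|phi]; last first.
  have [psi psiE] := QA_inj (G_fg fX) fGk phi pi.
  have [y yE] := free_refl psi; exists (p y) => g.
  by rewrite -psiE yE hmapE.
have [y yx] := ps x.
(* Evaluation at [y] vanishes on the image of G X, the kernel of G(d), so it factors through G(d)
   and a map on G(B^l), which is evaluation at some [z]. Then [y] and [d z] agree under every map to
   Q. *)
have [|h hE] := inj_ext noeA (f := lin (G_eval_lin (X := _) y)) fGk fGl QA_inj pex.
  by move=> g; rewrite /= happ_mk /= yx H; exact: (bm_lr0 (swap Q)).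
have [z zE] := free_refl h.
suff yz : y = d z by rewrite -yx yz; apply/ex; exists z.
apply/eqP; rewrite -subr_eq0; apply/eqP/free_sep => g.
rewrite linearB /=; apply/eqP; rewrite subr_eq0; apply/eqP.
apply: (can_inj (bm_rlK Q)).
by have := hE g; rewrite zE hmapE => /esym.
Qed.

(** The value of [phi g] at a point [p] is a functional of [g], hence by biduality the evaluation of
    [g] at a point [psi p]. *)
Lemma G_full (X Z : lmodType B) (phi : {linear G X -> G Z}) : fin_gen X ->
  exists psi : {linear Z -> X}, forall g, phi g = hmap (swap Q) psi g.
Proof.
move=> /fg_refl [sep refl].
have phil p : linear (fun g : G X => v (happ (phi g) p)).
  by move=> a g h; rewrite linZD; exact: G_eval_lin.
have /choice [psi psiE] := fun p => refl (lin (phil p)).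
have psiE' p g : happ (phi g) p = happ g (psi p).
  by apply: (can_inj (bm_rlK Q)); exact: psiE.
have psil : linear psi.
  move=> b x y; apply/eqP; rewrite -subr_eq0; apply/eqP/sep => g.
  by rewrite linearB /= linearD linearZ /= -!psiE' linZD subrr.
by exists (lin psil) => g; apply: hom_ext => p; rewrite hmapE psiE'.
Qed.

Fact FG_eval_subproof (X : lmodType B) (x : X) : linear (fun g : G X => v (happ g x)).
Proof. exact: G_eval_lin. Qed.

Lemma FG_iso (X : lmodType B) : fin_gen X -> retract X (F (G X)).
Proof.
move=> fX; have [sep refl] := fg_refl fX.
pose ev x : F (G X) := hmk (lin (@FG_eval_subproof X x)).
have evl : linear ev.
  apply: hom_lin => g b x y; rewrite !happ_mk /= linZD.
  by rewrite bm_rlD bm_lrD !bm_rlK.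
suff : bijective (lin evl) by move/retract_iso => [].
apply: inj_surj_bij.
  apply: lin_inj => x E; apply: sep => g.
  apply: (bm_lr_eq0 (swap Q)); exact: (congr1 (fun f => happ f g) E).
move=> f; have [x xE] := refl (happ f); exists x; apply: hom_ext => g.
by rewrite happ_mk xE.
Qed.

(** F(Q^k) is End_A(Q)^k, that is B^k. *)
Lemma F_pow_Q k : retract (F {ffun 'I_k -> QA}) {ffun 'I_k -> B^o}.
Proof.
have hl1 b : linear (fun q : {ffun 'I_k -> QA} => \sum_i v (b i *: u (q i))).
  move=> a x y; rewrite scaler_sumr -big_split; apply: eq_bigr => i _ /=.
  by rewrite !ffunE bm_lrD scalerDr bm_rlD bm_comm.
have hl : linear (fun b : {ffun 'I_k -> B^o} => hmk (lin (hl1 b)) : F {ffun 'I_k -> QA}).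
  apply: hom_lin => x t y z; rewrite !happ_mk /= !bm_lr_sum.
  rewrite scaler_sumr -big_split; apply: eq_bigr => i _ /=.
  by rewrite !bm_rlK !ffunE scalerDl scalerA.
suff : bijective (lin hl) by move/retract_iso => [].
apply: inj_surj_bij.
  apply: lin_inj => b E; apply/ffunP => i; rewrite ffunE; apply: faithB => m.
  have := congr1 (fun f => u (happ f (finj i (v m)))) E.
  rewrite /= happ_mk happ0 /= bm_lr0 (bigD1 i) //= big1 => [|j ji].
    by rewrite ffunE eqxx addr0 !bm_rlK.
  by rewrite ffunE (negbTE ji) bm_lr0 scaler0; exact: (bm_lr0 (swap Q)).
move=> f; have /choice [b bP] := fun i => full (lcomp (happ f) (finj i)).
exists [ffun i => b i]; apply: hom_ext => q; rewrite happ_mk (fsum_proj (happ f)) /=.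
by apply: eq_bigr => i _; rewrite ffunE; exact: esym (bP i (q i)).
Qed.

Lemma F_addQ J : addQ J -> fgproj (F J).
Proof.
move=> [k rJ]; apply: fgproj_retract (fgproj_free B k).
exact: retract_trans (retract_hom Q rJ) (F_pow_Q k).
Qed.

(** The surjective half of the biduality map; for modules in add Q the injective half is
    [addQ_sep]. *)
Definition reflexive (Y : lmodType A) : Prop :=
  forall phi : {linear F Y -> QB}, exists y, forall f, phi f = u (happ f y).

Lemma addQ_sep J : addQ J -> forall y : J, (forall f : F J, happ f y = 0) -> y = 0.
Proof.
move=> [k [s [r rs]]] y H; rewrite -(rs y) (_ : s y = 0) ?linear0 //.
apply/ffunP => i; rewrite ffunE.
exact: (H (hmk (lcomp (fproj i) s))).
Qed.

(** The coordinate projections generate F(Q^k) over [B], so a functional is evaluation at the vector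
    of its values on them. *)
Lemma addQ_refl J : addQ J -> reflexive J.
Proof.
move=> [k [s [r rs]]] phi.
pose pr i : F {ffun 'I_k -> QA} := hmk (fproj i).
pose phi' := lcomp phi (hmap Q s).
pose y := [ffun i => v (phi' (pr i))].
exists (r y) => f; pose f' := hmap Q r f.
have -> : f = hmap Q s f' by apply: hom_ext => x; rewrite !hmapE rs.
have /choice [b bP] := fun i => full (lcomp (happ f') (finj i)).
have f'E : f' = \sum_i b i *: pr i.
  apply: hom_ext => x.
  have -> : happ (\sum_i b i *: pr i) x = \sum_i happ (b i *: pr i) x.
    by elim/big_rec2: _ => // i z g _ <-.
  rewrite (fsum_proj (happ f')) /=; apply: eq_bigr => i _.
  exact: (bP i (x i)).
transitivity (phi' f') => //.
rewrite {1}f'E linear_sum hmapE.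
have -> : happ f' (s (r y)) = happ f' y by rewrite /f' !hmapE rs.
rewrite (fsum_proj (happ f')) /= bm_lr_sum; apply: eq_bigr => i _.
have := bP i (y i); rewrite /= => ->.
rewrite bm_rlK ffunE bm_rlK; exact: (linZ phi').
Qed.

Lemma F_restrict_surj (Y J : lmodType A) (i : {linear Y -> J}) : injective i -> fin_gen Y ->
  fin_gen J -> surj (hmap Q i).
Proof.
move=> ii fY fJ f; have [g gE] := QA_inj fY fJ (happ f) ii.
by exists (hmk g); apply: hom_ext => y; rewrite hmapE happ_mk gE.
Qed.

(** Pulled back to [F J], the functional is evaluation at some [j]. It kills everything coming from
    [F J'], so [d j = 0] and [j] lies in [Y]; and [F J] maps onto [F Y]. *)
Lemma exact_reflexive (Y J J' : lmodType A) (i : {linear Y -> J}) (d : {linear J -> J'}) :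
  fin_gen Y -> injective i -> exact_at i d -> addQ J -> addQ J' -> reflexive Y.
Proof.
move=> fY ii ex aJ aJ' phi.
have [j jE] := addQ_refl aJ (lcomp phi (hmap Q i)).
have /ex [y yE] : d j = 0.
  apply: (addQ_sep aJ') => f; apply: (bm_lr_eq0 Q).
  rewrite -(hmapE d) -jE; change (phi (hmap Q i (hmap Q d f)) = 0).
  rewrite (_ : hmap Q i _ = 0) ?linear0 //.
  apply: hom_ext => y; rewrite !hmapE happ0.
  by rewrite (proj2 (ex _) (ex_intro _ y erefl)) linear0.
exists y => f; have [f' <-] := F_restrict_surj ii fY (addQ_fgproj aJ).1 f.
by rewrite hmapE yE -jE.
Qed.

Lemma domdim_reflexive Z : fin_gen Z -> domdim_ge QA 2 Z -> reflexive Z.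
Proof.
move=> fZ [J [Z1 [i [p [[ii ps ex] aJ [J' [Z2 [i' [p' [[ii' _ _] aJ' _]]]]]]]]]].
apply: (@exact_reflexive Z J J' i (lcomp i' p)) => // y; rewrite -ex /=.
by split=> [H|->]; [apply: ii'; rewrite H linear0 | rewrite linear0].
Qed.

(** F turns the coresolution into the beginning of a projective resolution of [F Z]. At the last
    step a map from [F Z'] to Q is evaluation at a point of [Z'], and evaluation at a preimage in
    [J] extends it. Reflexivity of [Z'] takes two further terms, whence [m.+3]. *)
Lemma domdim_exS m Z : fin_gen Z -> domdim_ge QA m.+3 Z -> exS (ext1e QB) m (F Z).
Proof.
elim: m Z => [|m IH] Z fZ [J [Z' [i [p [sip aJ dZ']]]]];
  have [ii ps ex] := sip; have fJ := (addQ_fgproj aJ).1;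
  have fZ' := fg_ses_r sip fJ; have [hpi hpe] := hmap_exact Q ps ex;
  exists (F J), (F Z'), (hmap Q p), (hmap Q i); split; try exact: F_addQ;
  try (by split=> //; exact: F_restrict_surj).
  move=> f; have [z zE] := domdim_reflexive fZ' dZ' f.
  have [y yE] := ps z; exists (heval Q y) => g.
  by rewrite zE -yE.
exact: IH.
Qed.

Lemma Q_retract_FA : retract QB (F A^o).
Proof.
have hl : linear (fun m : QB => hmk (lscal (v m)) : F A^o).
  apply: hom_lin => x t y z; rewrite !happ_mk /=.
  by rewrite bm_rlD scalerDr bm_lrD (bm_comm_swap Q).
exists (lin hl), (heval Q 1) => m.
by rewrite /= happ_mk /= scale1r bm_rlK.
Qed.

(** * Q is n-cluster tilting over B, with endomorphism algebra A *)

Section HigherAuslander.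
Variable n : nat.
Hypothesis n_gt0 : (0 < n)%N.
Hypothesis gldimA : forall C : lmodType A, fin_gen C -> alS (@projective A) n.+1 C.
Hypothesis domdimA : domdim_ge QA n.+1 A^o.

(** Dominant dimension at least 2 makes the regular module reflexive, so evaluation at 1 on F A
    followed by [g] is evaluation at some [a]. *)
Lemma double_centralizer (g : {linear QB -> QB}) :
  exists a : A, forall m, g m = u (a *: v m).
Proof.
have [|a aE] := domdim_reflexive (fg_regular A) _ (lcomp g (heval Q 1)).
  by apply: domdim_ge_mono domdimA; rewrite ltnS.
exists a => m; have := aE (hmk (lscal (v m))).
by rewrite /= !happ_mk /= scale1r bm_rlK.
Qed.

Lemma in_add_Ext_left X i : in_add QB X -> (1 <= i <= n - 1)%N -> Ext_zero i X QB.
Proof.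
case: i => [//|i] [k /summand_retract rX] /andP[_ iln].
apply: (alS_Ext_zero (m := i)).
have rXF : stab X {ffun 'I_k -> F A^o}.
  apply: stab_retract; apply: retract_trans rX _; apply: retract_pow.
  exact: Q_retract_FA.
apply: (@exS_alS _ (ext1e QB) (ext1 QB) i _ _ _ rXF); first exact: stab_ext1.
apply: exS_ext1_pow; apply: domdim_exS; first exact: fg_regular.
(* [domdim_exS] asks for [i.+3 <= n.+1], which is the bound [i.+1 <= n - 1]. *)
apply: domdim_ge_mono domdimA; rewrite ltnS.
by move: iln; rewrite subn1 -ltnS prednK.
Qed.

Lemma Ext_zero_add_right Y X i : in_add QB X -> (0 < i)%N -> Ext_zero i Y QB -> Ext_zero i Y X.
Proof.
case: i => [//|i] [k /summand_retract [s [r rs]]] _ H P f fc.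
have /choice [g gE] : forall j, exists g : {linear pres_obj P i -> QB},
    forall x, s (f x) j = g (pres_d P i x).
  move=> j; apply: (H P (lcomp (fproj j) (lcomp s f))) => x /=.
  by rewrite fc linear0 ffunE.
exists (lcomp r (ftup g)) => x /=; rewrite -[LHS]rs; congr (r _).
by apply/ffunP => j; rewrite ffunE gE.
Qed.

Lemma Ext_zero_exact (X : lmodType B) i (P : proj_resolution X) : Ext_zero i.+1 X QB ->
  exact_at (hmap (swap Q) (pres_d P i)) (hmap (swap Q) (pres_d P i.+1)).
Proof.
move=> H g; split=> [g0|[f <-]]; last first.
  apply: hom_ext => x; rewrite !hmapE happ0.
  rewrite (proj2 (@pres_exact _ _ P i _) (ex_intro _ x erefl)).
  exact: linear0.
have [|f fE] := H P (happ g); first by move=> x; rewrite -(hmapE (pres_d P i.+1)) g0.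
by exists (Gmk f); apply: hom_ext => x; rewrite hmapE happ_mk fE.
Qed.

Lemma aug_hom_exact (X : lmodType B) (P : proj_resolution X) :
  injective (hmap (swap Q) (pres_aug P)) /\
  exact_at (hmap (swap Q) (pres_aug P)) (hmap (swap Q) (pres_d P 0)).
Proof. by apply: hmap_exact; [exact: pres_aug_surj | exact: pres_exact0]. Qed.

(** X is F(G X), and F sends summands of A^k to summands of Q^k. *)
Lemma in_add_of_projective X : fin_gen X -> projective (G X) -> in_add QB X.
Proof.
move=> fX pGX.
have [k rk] := hom_fgproj_retract Q (conj (G_fg fX) pGX).
by exists k; apply: retract_summand; apply: retract_trans (FG_iso fX) rk.
Qed.

Lemma G_pres_addQ (X : lmodType B) (P : proj_resolution X) i : addQ (G (pres_obj P i)).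
Proof. exact/G_addQ/pres_fgproj. Qed.

Lemma Ext_left_in_add X : fin_gen X ->
  (forall i, (1 <= i <= n - 1)%N -> Ext_zero i X QB) -> in_add QB X.
Proof.
move=> fX H; apply: in_add_of_projective => //.
have [P] := fg_resolution noeB fX.
(* Descent from j = n - 1: the kernel [Y] of G P_j -> G P_(j+1) has projective [j]-th syzygies. At
   the top it is a second syzygy and gldim A is at most n + 1; below, vanishing of Ext makes it a
   first syzygy of the next kernel. At j = 0 it is G X. *)
have D t j (Y : lmodType A) (i : {linear Y -> G (pres_obj P j)}) :
    (j + t = n - 1)%N -> injective i ->
    exact_at i (hmap (swap Q) (pres_d P j)) -> alS (@projective A) j Y.
  elim: t j Y i => [|t IH] j Y i jt ii ex.
    apply: (alS_second_syzygy ii ex); try exact/addQ_fgproj/G_pres_addQ.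
    have -> : j.+2 = n.+1 by rewrite -[n in RHS](prednK n_gt0) -subn1 -jt addn0.
    apply: gldimA; apply: fg_quot; apply/G_fg; exact: pres_fg.
  have exj := @Ext_zero_exact X j P (H j.+1 _).
  set d := hmap (swap Q) (pres_d P j) in ex exj *.
  set d' := hmap (swap Q) (pres_d P j.+1) in exj *.
  have {}exj : exact_at d d'.
    by apply: exj; rewrite /= -jt addnS ltnS leq_addr.
  have := IH j.+1 _ (sm_incl (ker_sm d')) _ (@sm_incl_inj _ _ _) (ker_exact d').
  rewrite addSnnS => /(_ jt) aK.
  have [q qE] := @sm_factor _ _ (ker_sm d') _ d
    (fun y => proj2 (exj _) (ex_intro _ y erefl)).
  apply: (aK _ _ i q (addQ_fgproj (G_pres_addQ P j))); split=> //.
    move=> z; have [y yE] := proj1 (exj _) (sm_inclP z).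
    by exists y; apply: sm_incl_inj; rewrite qE.
  move=> y; rewrite -ex -qE; split=> [->|E]; first exact: linear0.
  by apply: (@sm_incl_inj _ _ (ker_sm d')); rewrite E linear0.
have [ai aex] := aug_hom_exact P.
exact: (D (n - 1)%N 0%N _ _ (add0n _) ai aex).
Qed.

Fact act_subproof (a : A) : linear (fun m : QB => u (a *: v m)).
Proof. by move=> b x y; rewrite bm_rlD scalerDr bm_lrD (bm_comm_swap Q). Qed.

Fact endQ_subproof : linear (fun a : A^o => Gmk (lin (act_subproof a)) : G QB).
Proof.
apply: (@hom_lin _ _ (swap Q)) => z a x y; rewrite !happ_mk /=.
by rewrite !bm_lrK scalerDl scalerA.
Qed.
Definition endQ : {linear A^o -> G QB} := lin endQ_subproof.

(** A embeds in a module of add Q, whose points are separated by maps to Q. *)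
Lemma QA_faithful : faithful_module QA.
Proof.
move=> a a0; case: domdimA => J0 [Z [i [p [[ii _ _] aJ0 _]]]].
have /ii <- // : i (a : A^o) = i 0.
rewrite linear0; apply: (addQ_sep aJ0) => f.
by rewrite -[a]mulr1 -[i _]/(i (a *: (1 : A^o))) !linZ a0.
Qed.

Lemma endQ_inj : injective endQ.
Proof.
apply: lin_inj => a a0; apply: QA_faithful => q.
have := congr1 (fun g : G QB => v (happ g (u q))) a0.
by rewrite /= happ_mk /= happ0 !bm_lrK => ->; exact: (bm_lr0 (swap Q)).
Qed.

Lemma endQ_surj : surj endQ.
Proof.
move=> h; have [a aE] := double_centralizer (happ h); exists a.
by apply: hom_ext => m; rewrite aE.
Qed.

(** G sends Q to End_B(Q) = A, hence summands of Q to projective modules. *)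
Lemma G_summand_fgproj (N : lmodType B) : direct_summand N QB -> fgproj (G N).
Proof.
move=> /summand_retract rN; apply: fgproj_retract (retract_hom (swap Q) rN) _.
have [_ rA] := retract_iso (inj_surj_bij endQ_inj endQ_surj).
by apply: fgproj_retract rA _; split; [exact: fg_regular | exact: proj_regular].
Qed.

(** G applied to a resolution P of Q consists of injective modules and coresolves A as far as
    Ext^i(Q, Q) vanishes. Since G is full, cocycles G X -> G P_(k+1) come from cocycles P_(k+1) ->
    X, so the hypothesis lifts them and [balance] applies with bound n - 1. *)
Lemma Ext_right_in_add X : fin_gen X ->
  (forall i, (1 <= i <= n - 1)%N -> Ext_zero i QB X) -> in_add QB X.
Proof.
move=> fX H; apply: in_add_of_projective => //.
have [sep refl] := fg_refl fX.
have [P] := fg_resolution noeB QB_fg; have [PX] := fg_resolution noeB fX.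
pose J k := G (pres_obj P k).
pose d k : {linear J k -> J k.+1} := hmap (swap Q) (pres_d P k).
have [ai aex] := aug_hom_exact P.
pose eps : {linear A^o -> J 0%N} := lcomp (hmap (swap Q) (pres_aug P)) endQ.
have epsi : injective eps by exact: inj_comp ai endQ_inj.
have epse : exact_at eps (d 0%N).
  move=> g; rewrite aex; split=> [[h <-]|[a <-]]; last by exists (endQ a).
  by have [a <-] := endQ_surj h; exists a.
apply: (@balance A noeA J d eps _ _ _ epsi epse (n - 1)%N).
- by move=> k; apply/G_fg/pres_fg.
- by move=> k; apply/addQ_inj/G_pres_addQ.
- move=> k g; apply: hom_ext => x; rewrite !hmapE happ0.
  rewrite (proj2 (@pres_exact _ _ P k _) (ex_intro _ x erefl)).
  exact: linear0.
- exact: G_fg.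
- have [aXi aXex] := aug_hom_exact PX.
  apply: (alS_second_syzygy aXi aXex); try exact/addQ_fgproj/G_pres_addQ.
  rewrite subn1 prednK //; apply: gldimA; apply: fg_quot; apply/G_fg; exact: pres_fg.
- move=> k kn; apply: Ext_zero_exact; apply: in_add_Ext_left; last by rewrite /= ltnW.
  exact: in_add_refl.
- move=> k kn phi dphi.
  have [psi psiE] := G_full phi fX.
  have [|om omE] := H k.+1 kn P psi.
    move=> x; apply: sep => g; rewrite -(hmapE psi) -psiE.
    by have /(congr1 (fun h => happ h x)) := dphi g; rewrite hmapE.
  exists (hmap (swap Q) om) => g; apply: hom_ext => x.
  by rewrite psiE !hmapE -omE.
Qed.

Theorem QB_cluster_tilting : cluster_tilting n QB.
Proof.
split=> // X fX; split.
- by move=> aX i ri; exact: in_add_Ext_left.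
- exact: Ext_left_in_add.
- move=> aX i ri; apply: Ext_zero_add_right => //; first by case/andP: ri.
  by apply: in_add_Ext_left => //; exact: in_add_refl.
- exact: Ext_right_in_add.
Qed.

End HigherAuslander.
End Duality.

(** * Indecomposable summands *)

Section Fitting.
Variables (K : fieldType) (B : falgType K) (N : lmodType B).
Variable t : {linear N -> N}.

Fixpoint lpow k : {linear N -> N} := if k is k'.+1 then lcomp t (lpow k') else lid N.

Lemma lpowD k l x : lpow (k + l) x = lpow k (lpow l x).
Proof. by elim: k => //= k ->. Qed.

Lemma lpow_comm k x : lpow k.+1 x = lpow k (t x).
Proof. by rewrite -addn1 lpowD. Qed.

(** Images and kernels of the powers of [t] stabilise, so [N] is the direct sum of the kernel and
    the image of a high power; indecomposability leaves one of them. *)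
Lemma fitting : fin_gen N -> indecomposable N ->
  (exists k, forall x, lpow k x = 0) \/ bijective t.
Proof.
move=> fN [_ indN].
have [_ [k ->] kmin] := @min_submod K B N (fun U => exists k, U = im_sm (lpow k)) fN
  (ex_intro _ _ (ex_intro _ 0%N erefl)).
have [_ [l ->] lmax] := @max_submod K B N (fun U => exists k, U = ker_sm (lpow k)) fN
  (ex_intro _ _ (ex_intro _ 0%N erefl)).
(* The extra 1 makes [t] a factor of its [m]-th power, whose bijectivity then forces that of [t]. *)
have [m mE] : exists m, m = (k + l).+1 by exists (k + l).+1.
have kerm x : lpow m (lpow m x) = 0 -> lpow m x = 0.
  rewrite -lpowD => H; have {}H : lpow l x = 0.
    apply: (lmax (ker_sm (lpow (m + m)))) => [|y /= y0|//]; first by exists (m + m)%N.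
    rewrite /=; have -> : (m + m = (m + k.+1) + l)%N by rewrite {2}mE -addnA addSn.
    by rewrite lpowD y0 linear0.
  by rewrite mE -addSn lpowD H linear0.
have imm x : exists y, lpow m (lpow m y) = lpow m x.
  have [|y|| y yE] := kmin (im_sm (lpow (m + m))) _ _ (lpow m x).
  - by exists (m + m)%N.
  - case=> z /= <-; exists (lpow (m + m - k) z).
    by rewrite -lpowD subnKC // {1}mE addSn -addnS -addnA leq_addr.
  - by exists (lpow l.+1 x); rewrite -lpowD addnS mE.
  by exists y; rewrite -lpowD.
have [W1 [i1 [i1i i1x]]] : exists (W : lmodType B) (i : {linear W -> N}), injective i /\ exact_at i (lpow m).
  by exists (smT (ker_sm (lpow m))), (sm_incl _); split; [exact: sm_incl_inj | exact: ker_exact].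
have [W2 [i2 [i2i i2x]]] : exists (W : lmodType B) (i : {linear W -> N}), injective i /\
    forall y, (exists w, i w = y) <-> exists x, lpow m x = y.
  exists (smT (im_sm (lpow m))), (sm_incl _); split; first exact: sm_incl_inj.
  by move=> y; split=> [[w <-]|]; [exact: (sm_inclP w) | exact: (@sm_incl_ex _ _ (im_sm _))].
have i1m w : lpow m (i1 w) = 0 by apply/i1x; exists w.
pose f := ladd (lcomp i1 (@lfst _ W1 W2)) (lcomp i2 (@lsnd _ W1 W2)).
have fE w w' : f (w, w') = i1 w + i2 w' by [].
have fb : bijective f.
  apply: inj_surj_bij.
    apply: lin_inj => -[w w']; rewrite fE => E.
    have [x xE] : exists x, lpow m x = i2 w' by apply/i2x; exists w'.
    have w'0 : w' = 0.
      apply: i2i; rewrite linear0 -xE; apply: kerm.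
      by rewrite xE; have := congr1 (lpow m) E; rewrite linearD linear0 i1m add0r.
    have w0 : w = 0 by apply: i1i; move: E; rewrite w'0 !linear0 addr0.
    by rewrite w0 w'0.
  move=> x; have [y yE] := imm x.
  have [w' w'E] : exists w', i2 w' = lpow m y by apply/i2x; exists y.
  have [w wE] : exists w, i1 w = x - lpow m y by apply/i1x; rewrite linearB /= yE subrr.
  by exists (w, w'); rewrite fE wE w'E subrK.
case: (indN _ _ f fb) => Z0; [right | left].
  apply: inj_surj_bij.
    apply: lin_inj => x tx; have /i1x [w <-] : lpow m x = 0 by rewrite mE lpow_comm tx linear0.
    by rewrite (Z0 w) linear0.
  have [g _ fK] := fb => x; have := fK x; case: (g x) => w w'.
  rewrite fE (Z0 w) linear0 add0r => <-.
  have [y <-] : exists y, lpow m y = i2 w' by apply/i2x; exists w'.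
  by exists (lpow (k + l) y); rewrite mE.
exists m => x; have [w <-] : exists w, i2 w = lpow m x by apply/i2x; exists x.
by rewrite (Z0 w) linear0.
Qed.
End Fitting.

(** * Indecomposable summands over a QF-1 algebra *)

Section QF1.
Variables (K : fieldType) (A B : falgType K) (Q : bimod A B).
Local Notation QA := (bm_l Q).
Local Notation QB := (bm_r Q).
Local Notation u := (bm_lr Q).
Local Notation v := (bm_rl Q).
Local Notation G := (hom (swap Q)).
Hypotheses (QA_fgp : fgproj QA) (QA_inj : injective_module QA).
Hypothesis full : forall f : {linear QA -> QA},
  exists b : B, forall q, f q = v (b *: u q).
Hypothesis faithB : forall b : B, (forall m : QB, b *: m = 0) -> b = 0.
Hypothesis QA_faith : faithful_module QA.
Hypothesis QF1A : forall M : lmodType A, fin_gen M -> faithful_module M -> balanced M.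

Let noeA : noeth A := @falg_noeth K A.
Let noeB : noeth B := @falg_noeth K B.

(** Otherwise every endomorphism of Q + S is diagonal and commutes with the projection onto S, which
    is then multiplication by some [a]. This [a] kills the faithful Q, so [a = 0] and S = 0. *)
Lemma QF1_hom (S : lmodType A) : fin_gen S -> ~ zero_module S ->
  (exists (f : {linear QA -> S}) q, f q <> 0) \/
  (exists (h : {linear S -> QA}) s, h s <> 0).
Proof.
move=> fS S0; apply: contrapT => /not_orP [nf nh].
have f0 (f : {linear QA -> S}) q : f q = 0.
  by apply: contrapT => fq; apply: nf; exists f, q.
have h0 (h : {linear S -> QA}) s : h s = 0.
  by apply: contrapT => hs; apply: nh; exists h, s.
pose M : lmodType A := (QA * S)%type.
have fM : fin_gen M by apply: fg_prod => //; exact: QA_fgp.1.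
have faM : faithful_module M.
  by move=> a aM; apply: QA_faith => q; have := congr1 fst (aM (q, 0)).
pose e : {linear M -> M} := lpair (lzero _ _) (@lsnd _ _ _).
have [|a aE] := QF1A fM faM (f := e).
  move=> g [q s].
  have g1 : (g (0, s)).1 = 0.
    exact: (h0 (lcomp (@lfst _ _ _) (lcomp g (lpair (lzero _ _) (lid S))))).
  have g2 : (g (q, 0)).2 = 0.
    exact: (f0 (lcomp (@lsnd _ _ _) (lcomp g (lpair (lid QA) (lzero _ _))))).
  change ((0, (g (q, s)).2) = g (0, s)).
  have -> : (q, s) = (q, 0) + (0, s) :> M.
    by apply/eqP; rewrite /eq_op /= addr0 add0r !eqxx.
  by rewrite linearD /= g2 add0r; case: (g (0, s)) g1 => /= x y ->.
have a0 : a = 0.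
  by apply: QA_faith => q; have := congr1 fst (aE (q, 0)).
by apply: S0 => s; have := congr1 snd (aE (0, s)); rewrite /= a0 scale0r.
Qed.

Theorem QF1_summand (N : lmodType B) : fin_gen N -> indecomposable N ->
  fgproj (G N) -> projective N \/ injective_module N.
Proof.
move=> fN indN [fP pP]; set P := G N in fP pP.
have [sep _] := fg_refl noeA noeB QA_fgp QA_inj full faithB fN.
(* A maximal proper submodule of G N; zero is proper because [N] is nonzero and its points are
   separated by maps to Q. *)
have [U0 [x0 Ux0] Umax] : exists2 U : submod P, (exists x, ~ U x) &
    forall V : submod P, (exists x, ~ V x) -> (forall x, U x -> V x) ->
    forall x, V x -> U x.
  apply: max_submod => //; exists (im_sm (lzero P P)).
  have [[p p0]|np] := pselect (exists p : P, p <> 0).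
    by exists p => -[q /= q0]; apply: p0.
  case: indN.1 => x; apply: sep => g.
  by rewrite (contrapT (fun g0 => np (ex_intro _ g g0))).
pose S := quot U0; pose pi : {linear P -> S} := quot_pi U0.
have pi_surj : surj pi by exact: quot_pi_surj.
have pi0 x : pi x = 0 <-> U0 x by exact: quot_pi0.
have fS : fin_gen S by exact: fg_quot.
have big (V : submod P) : (forall x, U0 x -> V x) -> (exists2 x, V x & ~ U0 x) ->
    forall x, V x.
  move=> UV [x Vx Ux] y; apply: contrapT => Vy.
  by apply: Ux; apply: (Umax V) => //; exists y.
(* The endomorphism of [N] inducing [t] is nilpotent or bijective by Fitting's lemma; nilpotency
   would give [pi x0 = 0]. *)
have t_bij (t : {linear P -> P}) : (forall x, pi (t x) = pi x) -> bijective t.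
  move=> tpi; have [t' t'E] := G_full noeA noeB QA_fgp QA_inj full faithB t fN.
  case: (fitting t' fN indN) => [[k k0]|/linear_inverse [r [tr rt]]]; last first.
    exists (hmap (swap Q) r) => g; apply: hom_ext => x.
      by rewrite hmapE t'E hmapE rt.
    by rewrite t'E !hmapE tr.
  case: Ux0; apply/pi0.
  have E : forall k, pi (hmap (swap Q) (lpow t' k) x0) = pi x0.
    move=> l; elim: l => [|l IH]; first by congr (pi _); apply: hom_ext.
    rewrite -IH -[RHS]tpi t'E; congr (pi _); apply: hom_ext => x.
    by rewrite !hmapE lpow_comm.
  rewrite -(E k) (_ : hmap _ _ _ = 0) ?linear0 //.
  by apply: hom_ext => x; rewrite hmapE k0 linear0.
(* A proper [V] outside [U0] would map onto [S]. Lifting [pi] through [V] gives an endomorphism of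
   [P] with image in [V], bijective by [t_bij]. So [U0] is the largest proper submodule. *)
have sub_ker (V : submod P) : (exists x, ~ V x) -> forall x, V x -> U0 x.
  move=> [y Vy] x Vx; apply: contrapT => Ux; apply: Vy.
  have ws : surj (lcomp pi (sm_incl V)).
    have imV : forall z, exists w, pi (sm_incl V w) = pi z.
      have Wok : is_submodule (fun z => exists w, pi (sm_incl V w) = pi z).
        split=> [|a z z' [w wE] [w' w'E]]; first by exists 0; rewrite !linear0.
        by exists (a *: w + w'); rewrite (linZD (sm_incl V)) !(linZD pi) wE w'E.
      apply: (big (Submod Wok)) => [z /pi0 z0|]; first by exists 0; rewrite z0 !linear0.
      by exists x => //; have [w <-] := sm_incl_ex Vx; exists w.
    by move=> s; have [z <-] := pi_surj s.
  have [sg sgE] := pP _ _ (fg_sub noeA V fP) fS (lcomp pi (sm_incl V)) pi ws.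
  have [r _ rK] := t_bij (lcomp (sm_incl V) sg) sgE.
  by rewrite -(rK y); exact: sm_inclP.
have S0 : ~ zero_module S by move=> H; apply: Ux0; apply/pi0; exact: H.
case: (QF1_hom fS S0) => [[f [q fq]]|[h [s hs]]]; [left | right].
  (* [f] is onto because it is nonzero and [S] is simple. *)
  have fs : surj f.
    have imf : forall z, exists w, f w = pi z.
      have Wok : is_submodule (fun z => exists w, f w = pi z).
        split=> [|a z z' [w wE] [w' w'E]]; first by exists 0; rewrite !linear0.
        by exists (a *: w + w'); rewrite (linZD f) (linZD pi) wE w'E.
      apply: (big (Submod Wok)) => [z /pi0 z0|]; first by exists 0; rewrite z0 linear0.
      have [z zE] := pi_surj (f q); exists z; first by exists q.
      by move=> /pi0; rewrite zE.
    by move=> s; have [z <-] := pi_surj s.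
  (* Lift [pi] and [f] through each other. The composite [r a] is the identity modulo [U0], hence
     bijective, and [P] is a summand of Q. *)
  have [a aE] := pP _ _ QA_fgp.1 fS f pi fs.
  have [r rE] := QA_fgp.2 _ _ fP fS pi f pi_surj.
  have /linear_inverse [ti [tiK _]] : bijective (lcomp r a).
    by apply: t_bij => x; change (pi (r (a x)) = pi x); rewrite rE aE.
  have aP : summand_pow QA P.
    apply: summand_pow_retract.
    by exists a, (lcomp ti r) => x; exact: tiK.
  apply: proj_retract (F_addQ full faithB aP).2.
  exact: (FG_iso noeA noeB QA_fgp QA_inj full faithB fN).
move=> X Y fX fY g f gi.
pose Gg := hmap (swap Q) g; pose c := quot_pi (im_sm Gg); pose f' := hmap (swap Q) f.
have fGX := G_fg noeA QA_fgp fX; have fGY := G_fg noeA QA_fgp fY.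
have [sepX reflX] := fg_refl noeA noeB QA_fgp QA_inj full faithB fX.
(* A map from the cokernel to Q pulls back to evaluation at some [x] on G X. It kills the image of
   [Gg], so every map from [Y] to Q vanishes at [g x]; hence [x = 0]. *)
have Hom_c0 (ka : {linear quot (im_sm Gg) -> QA}) z : ka z = 0.
  have [y <-] := quot_pi_surj z.
  have [x xE] := reflX (lcomp ka c).
  have -> : ka (quot_pi _ y) = v (happ y x) := xE y.
  suff -> : x = 0 by rewrite linear0; exact: (bm_lr0 (swap Q)).
  apply: gi; rewrite linear0.
  have [sepY _] := fg_refl noeA noeB QA_fgp QA_inj full faithB fY.
  apply: sepY => w; apply: (bm_lr_eq0 (swap Q)).
  rewrite -(hmapE g) -[bm_lr _ _]xE; change (ka (c (Gg w)) = 0).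
  rewrite (_ : c (Gg w) = 0) ?linear0 //.
  by apply/quot_pi0; exists w.
(* Otherwise the kernel of [th] is proper, so it lies in [U0] and [h pi] factors through [th];
   extended to the cokernel, this contradicts [Hom_c0]. *)
have cf0 p : c (f' p) = 0.
  apply: contrapT => cp.
  pose th := lcomp c f'.
  have [ka kaE] : exists ka : {linear quot (im_sm Gg) -> QA}, forall y, ka (th y) = lcomp h pi y.
    apply: (inj_ext noeA fP (fg_quot _ fGX) QA_inj (ker_exact th)) => w.
    change (h (pi (sm_incl _ w)) = 0); rewrite (_ : pi _ = 0) ?linear0 //; apply/pi0.
    by apply: (sub_ker (ker_sm th)); [exists p | exact: sm_inclP].
  have [z zs] := pi_surj s.
  by apply: hs; rewrite -zs -[h _]kaE Hom_c0.
(* As [P] is projective, [f'] factors through [Gg]; fullness of G turns the factor into an extension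
   of [f]. *)
have [k kE] := proj_lift noeA fGY fGX pP (coker_exact Gg) cf0.
have [k' k'E] := G_full noeA noeB QA_fgp QA_inj full faithB k fN.
exists k' => x; apply/eqP; rewrite -subr_eq0; apply/eqP/sep => p.
rewrite linearB /= -(hmapE k') -k'E -(hmapE g) -(hmapE f) -[hmap _ g _]/(Gg _) kE.
by rewrite subrr.
Qed.

End QF1.

(** * Construction of the bimodule *)

Section Centraliser.
Variables (K : fieldType) (m : nat) (W : {vspace 'M[K]_m.+1}).

Definition cent_alg : falgType K := subvs_of 'C(W)%AS.

Lemma cent_algM (b c : cent_alg) : vsval (b * c) = vsval b *m vsval c.
Proof. by []. Qed.
Lemma cent_alg1 : vsval (1 : cent_alg) = 1%:M.
Proof. by apply: (eqP (_ : algid 'C(W)%AS == 1)); rewrite algid_eq1 centv1. Qed.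

(** The vacuous mention of [W] makes it a parameter of the type, so that the action of the
    centraliser of [W] is determined by the type. *)
Definition colmod : Type := let _ := W in 'cV[K]_m.+1.
HB.instance Definition _ := GRing.Zmodule.on colmod.
Let cscale (b : cent_alg) (x : colmod) : colmod := vsval b *m x.
Fact cscaleA a b v : cscale a (cscale b v) = cscale (a * b) v.
Proof. by rewrite /cscale cent_algM mulmxA. Qed.
Fact cscale1 : left_id 1 cscale.
Proof. by move=> v; rewrite /cscale cent_alg1 mul1mx. Qed.
Fact cscaleDr : right_distributive cscale +%R.
Proof. by move=> a x y; exact: mulmxDr. Qed.
Fact cscaleDl v : {morph cscale^~ v : a b / a + b}.
Proof. by move=> a b; rewrite /cscale linearD; exact: mulmxDl. Qed.
HB.instance Definition _ := GRing.Zmodule_isLmodule.Build cent_alg colmod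
  cscaleA cscale1 cscaleDr cscaleDl.

Lemma colmodE (b : cent_alg) (x : colmod) : b *: x = (vsval b *m x : 'cV_m.+1).
Proof. by []. Qed.

Lemma colmod_scalar (k : K) (x : colmod) :
  (k%:A : cent_alg) *: x = (k *: (x : 'cV_m.+1) : 'cV_m.+1).
Proof.
rewrite colmodE (_ : vsval _ = k *: 1%:M); first by rewrite -scalemxAl mul1mx.
by rewrite -cent_alg1; exact: linearZ.
Qed.

Lemma colmod_fg : fin_gen colmod.
Proof.
exists m.+1, (fun i => delta_mx i 0 : 'cV[K]_m.+1) => x.
exists (fun i => ((x : 'cV_m.+1) i 0)%:A).
under eq_bigr do rewrite colmod_scalar.
rewrite [LHS](matrix_sum_delta (x : 'cV_m.+1)); apply: eq_bigr => i _.
by rewrite big_ord1.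
Qed.
End Centraliser.

Lemma linear_mx (K : fieldType) m (f : {linear 'cV[K]_m -> 'cV[K]_m}) :
  exists M : 'M[K]_m, forall x, M *m x = f x.
Proof.
exists (\matrix_(i, j) f (delta_mx j 0) i 0) => x; apply/matrixP => i k.
rewrite ord1 mxE [in RHS](matrix_sum_delta x) linear_sum summxE.
apply: eq_bigr => j _; rewrite big_ord1 linearZ !mxE.
by rewrite mulrC.
Qed.

Section EndomorphismAlgebra.
Variables (K : fieldType) (A : falgType K) (N : lmodType A).
Hypotheses (N_fg : fin_gen N) (N_nz : ~ zero_module N).

(* [A] acts by [K]-linear maps on the space of coordinates of [N], and the
   algebra of endomorphisms of [N] becomes a centraliser in a matrix algebra. *)
Lemma endomorphism_bimod : exists (B : falgType K) (Q : bimod A B),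
  [/\ bm_l Q = N, fin_gen (bm_r Q),
      forall f : {linear bm_l Q -> bm_l Q},
        exists b : B, forall q, f q = bm_rl Q (b *: bm_lr Q q),
      forall b : B, (forall x : bm_r Q, b *: x = 0) -> b = 0
    & forall (k : K) a (x : bm_r Q),
        bm_lr Q ((k *: a) *: bm_rl Q x) = (k%:A : B) *: bm_lr Q (a *: bm_rl Q x)].
Proof.
have [m [c [d cK dK]]] := fin_gen_coord (kmod_fg N_fg).
(* Dimension 0 is excluded as [N] is nonzero; size m + 1 keeps the matrix ring nonzero. *)
case: m c d cK dK => [|m] c d cK dK.
  case: N_nz => x; apply: (can_inj cK); apply/matrixP => i; by case: i.
have dl : linear d by exact: linv_subproof cK dK.
have rhol a : linear (fun x : 'cV[K]_m.+1 => c (a *: (d x : N))).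
  move=> k x y; rewrite dl -linZD; congr (c _).
  by rewrite -kmod_scaleC; exact: (scalerDr a (k *: d x : N) (d y)).
have /choice [rho rhoE] := fun a => linear_mx (lin (rhol a)).
have mx_eq (M M' : 'M[K]_m.+1) : (forall x : 'cV_m.+1, M *m x = M' *m x) -> M = M'.
  move=> E; apply/row_matrixP => i; apply/rowP => j.
  have := congr1 (fun v : 'cV_m.+1 => v i 0) (E (delta_mx j 0)).
  by rewrite -!colE !mxE.
have rho_sub : is_submodule (fun M => exists a, rho a = M).
  split=> [|k _ _ [a <-] [b <-]].
    by exists 0; apply: mx_eq => x; rewrite rhoE /= scale0r linear0 mul0mx.
  exists (k *: a + b); apply: mx_eq => x.
  rewrite mulmxDl -scalemxAl !rhoE /= -linZD; congr (c _).
  by rewrite -kmod_scaleAl; exact: (scalerDl (d x : N) (k *: a) b).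
(* [W] consists of the matrices of [A]; a matrix commutes with all of them exactly when it
   represents an [A]-linear map. *)
have [W WP] := submod_vspace (Submod rho_sub).
pose B := cent_alg W; pose QB : lmodType B := colmod W.
have cent (b : B) a : vsval b *m rho a = rho a *m vsval b.
  by have /centvP := subvsP b; apply; apply/WP; exists a.
have comm a (t : B) (q : N) :
    d (t *: (c (a *: q) : QB)) = a *: (d (t *: (c q : QB)) : N) :> N.
  apply: (can_inj cK); rewrite dK !colmodE.
  have -> : c (a *: q) = rho a *m c q by rewrite rhoE /= cK.
  by rewrite mulmxA cent -mulmxA rhoE.
pose Q := @Bimod A B N QB c d cK dK (fun x y => linearD c x y) comm.
exists B, Q; split=> //.
- exact: colmod_fg.
- move=> f.
  have fl : linear (fun x : 'cV[K]_m.+1 => c (f (d x))).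
    move=> k x y; rewrite dl -linZD; congr (c _).
    by rewrite [LHS]linZD.
  have [M ME] := linear_mx (lin fl).
  have MC : M \in 'C(W)%VS.
    apply/centvP => _ /WP [a <-]; apply: mx_eq => x.
    change (M *m rho a *m x = rho a *m M *m x).
    rewrite -!mulmxA !ME !rhoE /= !cK; congr (c _); exact: (linZ f a (d x)).
  exists (vsproj _ M) => q; apply: (can_inj cK).
  by rewrite /= dK colmodE vsprojK // ME /= cK.
- move=> b b0; apply: subvs_inj; apply: mx_eq => x.
  by rewrite linear0 mul0mx; exact: (b0 x).
- move=> k a x; rewrite colmod_scalar /= -linearZ; congr (c _).
  exact: kmod_scaleAl.
Qed.
End EndomorphismAlgebra.

(** * Modules over a semisimple algebra *)

Section Semisimple.
Variables (K : fieldType) (A : falgType K).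
Hypothesis ssA : semisimple_module A^o.
Implicit Types M X Y : lmodType A.

Lemma sm_sum M (U : submod M) (I : finType) (F : I -> M) :
  (forall i, U (F i)) -> U (\sum_i F i).
Proof. by move=> H; elim/big_ind: _ => //; [exact: sm0 | exact: smD]. Qed.

(** Take [V] maximal with zero intersection with [U]. A simple summand of A whose image under [h] is
    not inside U + V has image meeting U + V only in 0, so adding that image to [V] would contradict
    maximality. *)
Lemma complement Y (U : submod Y) : fin_gen Y -> exists V : submod Y,
  (forall x, U x -> V x -> x = 0) /\ forall x, exists2 y, U y & V (x - y).
Proof.
move=> fY.
have [|V UV Vmax] := @max_submod _ _ Y (fun V => forall x, U x -> V x -> x = 0) fY.
  by exists (im_sm (lzero Y Y)) => x _ [y /= <-].
exists V; split=> //.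
have Tok : is_submodule (fun x => exists2 y, U y & V (x - y)).
  split=> [|a x x' [y Uy Vy] [y' Uy' Vy']].
    by exists 0; rewrite ?subr0; exact: sm0.
  exists (a *: y + y'); first by apply: smD => //; exact: smZ.
  by rewrite opprD addrACA -scalerBr; apply: smD => //; exact: smZ.
pose T := Submod Tok.
have VT x : V x -> T x by move=> Vx; exists 0; rewrite ?subr0 //; exact: sm0.
have UT x : U x -> T x by move=> Ux; exists x; rewrite ?subrr //; exact: sm0.
have [k [g gP]] := fY; have [n [S [iota [simS iotaP _]]]] := ssA.
suff H i j s : T (iota i s *: g j).
  move=> x; have [c ->] := gP x; apply: (@sm_sum _ T) => j.
  have [y ->] := iotaP (c j); rewrite scaler_suml; apply: sm_sum => i; exact: H.
pose h : {linear S i -> Y} := lcomp (lscal (g j)) (iota i).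
apply: contrapT => nT.
have hok : is_submodule (fun s => T (h s)).
  split=> [|a x y Tx Ty]; first by rewrite linear0; exact: sm0.
  by rewrite linZD; apply: smD => //; exact: smZ.
case: ((simS i).2 _ hok) => [h0|hT]; last exact: nT (hT s).
have V'ok : is_submodule (fun x => exists s, V (x - h s)).
  split=> [|a x y [s1 V1] [s2 V2]]; first by exists 0; rewrite linear0 subr0; exact: sm0.
  exists (a *: s1 + s2); rewrite linZD opprD addrACA -scalerBr.
  by apply: smD => //; exact: smZ.
apply: nT; apply: (VT _); apply: (Vmax (Submod V'ok)) => [x Ux [s1 V1]|x Vx|].
- have s10 : s1 = 0.
    apply: h0; rewrite -[h s1](subKr x); apply: (@smD _ _ T); first exact: UT.
    by apply: (@smN _ _ T); apply: VT.
  by apply: UV => //; move: V1; rewrite s10 linear0 subr0.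
- by exists 0; rewrite linear0 subr0.
- by exists s; rewrite subrr; exact: sm0.
Qed.

Lemma semisimple_projective M : projective M.
Proof.
move=> X Y fX fY p f ps; have [V [kV sV]] := complement (ker_sm p) fX.
have : bijective (lcomp p (sm_incl V)).
  apply: inj_surj_bij.
    apply: lin_inj => x px; apply: sm_incl_inj; rewrite linear0.
    by apply: kV => //; exact: sm_inclP.
  move=> y; have [x <-] := ps y; have [z pz /sm_incl_ex [w wE]] := sV x.
  exists w; change (p (sm_incl V w) = p x).
  by rewrite wE linearB (pz : p z = 0) subr0.
move=> /linear_inverse [q [_ qK]].
by exists (lcomp (lcomp (sm_incl V) q) f) => x; exact: (qK (f x)).
Qed.

Lemma semisimple_injective M : injective_module M.
Proof.
move=> X Y fX fY g f gi; have [V [kV sV]] := complement (im_sm g) fY.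
have : bijective (lcomp (quot_pi V) g).
  apply: inj_surj_bij.
    apply: lin_inj => x /quot_pi0 Vx; apply: gi; rewrite linear0.
    by apply: kV => //; exists x.
  move=> y; have [z <-] := quot_pi_surj y; have [_ [x <-] Vx] := sV z.
  exists x; apply/eqP; rewrite -subr_eq0; apply/eqP.
  rewrite -[lcomp _ _ _]/(quot_pi V (g x)) -linearB; apply/quot_pi0.
  by rewrite -opprB; exact: smN.
move=> /linear_inverse [q [qK _]].
by exists (lcomp f (lcomp q (quot_pi V))) => x; rewrite /= -[in RHS](qK x).
Qed.

End Semisimple.

(** * From minimal coresolutions to a single projective-injective module *)

Section Coresolution.
Variables (R : nzRingType) (N : lmodType R).

Lemma summand_pow_zero (Z : lmodType R) : zero_module Z -> summand_pow N Z.
Proof. by move=> Z0; exists 0%N, (lzero _ _), (lzero _ _) => x; rewrite [RHS]Z0. Qed.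

Lemma domdim_ge_zero m (Z : lmodType R) : zero_module Z -> domdim_ge N m Z.
Proof.
move=> Z0; elim: m => //= m IH; exists Z, Z, (lid Z), (lid Z); split=> //.
  split=> // [x|y]; first by exists x.
  by split=> [|_]; [exists y | rewrite [LHS]Z0].
exact: summand_pow_zero.
Qed.

(** The coresolution is [Z] itself followed by zeros; this serves the semisimple case. *)
Lemma domdim_ge_summand_pow m (Z : lmodType R) : summand_pow N Z -> domdim_ge N m Z.
Proof.
case: m => //= m aZ; exists Z, {ffun 'I_0 -> Z}, (lid Z), (lzero _ _).
have Z0 : zero_module {ffun 'I_0 -> Z} by move=> x; apply/ffunP => -[].
split=> //; last exact: domdim_ge_zero.
split=> // [y|y]; first by exists 0; rewrite [RHS]Z0.
by split=> // _; exists y.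
Qed.

(** The coresolution is cut into short exact sequences at the images of its differentials. *)
Lemma coresolution_domdim_ge M (I : min_inj_coresolution M) d :
  (forall i, (i < d)%N -> summand_pow N (cores_obj I i)) -> domdim_ge N d M.
Proof.
move=> aI.
have H m j (Z : lmodType R) (i : {linear Z -> cores_obj I j}) :
    (j + m <= d)%N -> injective i -> exact_at i (cores_d I j) -> domdim_ge N m Z.
  elim: m j Z i => //= m IH j Z i jm ii ex.
  have [p pE] := @sm_factor _ _ (im_sm (cores_d I j)) _ (cores_d I j)
    (fun y => ex_intro _ y erefl).
  exists (cores_obj I j), (smT (im_sm (cores_d I j))), i, p; split.
  - split=> // [y|y].
      have [x xE] := sm_inclP y; exists x; apply: sm_incl_inj; rewrite pE; exact: xE.
    rewrite -ex -pE; split=> [->|E]; first exact: linear0.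
    by apply: (@sm_incl_inj _ _ (im_sm (cores_d I j))); rewrite E linear0.
  - by apply: aI; apply: leq_trans jm; rewrite addnS ltnS leq_addr.
  - apply: (IH j.+1 _ (sm_incl (im_sm (cores_d I j)))); first by rewrite addSnnS.
      exact: sm_incl_inj.
    move=> y; rewrite (@cores_exact _ _ I j); split=> [|[x <-]].
      exact: (@sm_incl_ex _ _ (im_sm (cores_d I j))).
    exact: (sm_inclP x).
exact: (H d 0%N M _ (leqnn _) (@cores_aug_inj _ _ I) (@cores_exact0 _ _ I)).
Qed.

End Coresolution.

(** [N] is the direct sum of the first [d] modules. *)
Lemma common_summand (R : nzRingType) (J : nat -> lmodType R) d :
  (forall i, (i < d)%N -> fgproj (J i) /\ injective_module (J i)) ->
  exists N : lmodType R, [/\ fgproj N, injective_module N &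
    forall i, (i < d)%N -> retract (J i) N].
Proof.
elim: d => [|d IH] H.
  have Z0 : zero_module ({ffun 'I_0 -> R^o} : lmodType R) by move=> x; apply/ffunP => -[].
  exists {ffun 'I_0 -> R^o}; split=> //; first exact: zero_fgproj.
  move=> X Y _ _ g f _; exists (lzero _ _) => x.
  by rewrite [LHS]Z0 [RHS]Z0.
have [|N [fN iN rN]] := IH; first by move=> i id; apply: H; rewrite ltnW.
have [fJ iJ] := H d (leqnn _).
exists (N * J d)%type; split; [exact: fgproj_prod | exact: inj_prod | ].
move=> i; rewrite ltnS leq_eqVlt => /orP [/eqP ->|/rN [s [r rs]]].
  by exists (lpair (lzero _ _) (lid _)), (@lsnd _ _ _).
by exists (lpair s (lzero _ _)), (lcomp r (@lfst _ _ _)).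
Qed.

(* Both cases of the definition, with the semisimple one counted as [n = 1]. *)
Lemma higher_Auslander_data (K : fieldType) (A : falgType K) :
  higher_Auslander A -> exists (n : nat) (N : lmodType A),
  [/\ (0 < n)%N, fgproj N, injective_module N,
      forall C : lmodType A, fin_gen C -> alS (@projective A) n.+1 C
    & domdim_ge N n.+1 A^o].
Proof.
case=> [[d [d2 [gd _] [I [_ pI]]]]|ssA].
  case: d d2 gd pI => [//|n] n0 gd pI.
  have [|N [fN iN rN]] := @common_summand A (cores_obj I) n.+1.
    move=> i ni; split; [split; [exact: cores_fg | exact: pI] | exact: cores_inj].
  exists n, N; split=> // [C fC|]; first exact/pdim_le_alS/gd.
  apply: (coresolution_domdim_ge (I := I)) => i ni.
  exact/summand_pow_retract/rN.
exists 1%N, A^o; split=> //.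
- by split; [exact: fg_regular | exact: proj_regular].
- exact: semisimple_injective.
- by move=> C _ P C1 i p _ _ P' C2 i' p' _ _; exact: semisimple_projective.
- exact/domdim_ge_summand_pow/summand_pow_retract/retract_refl.
Qed.

(** A central idempotent of [B] acts on Q by a [B]-linear map, hence as an element of [A];
    faithfulness makes this element a central idempotent. *)
Lemma connected_transfer (A B : nzRingType) (Q : bimod A B) :
  faithful_module (bm_l Q) ->
  (forall b : B, (forall m : bm_r Q, b *: m = 0) -> b = 0) ->
  (forall g : {linear bm_r Q -> bm_r Q}, exists a : A, forall m,
      g m = bm_lr Q (a *: bm_rl Q m)) ->
  connected_ring A -> connected_ring B.
Proof.
move=> faithA faithB dc connA e ee ce.
have el : linear (fun m : bm_r Q => e *: m).
  by move=> b x y; rewrite scalerDr !scalerA ce.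
have [a aE] := dc (lin el); rewrite /= in aE.
have aq q : a *: q = bm_rl Q (e *: bm_lr Q q) by rewrite aE !bm_lrK.
have aeq x y : (forall q : bm_l Q, x *: q = y *: q) -> x = y.
  move=> xy; apply/eqP; rewrite -subr_eq0; apply/eqP/faithA => q.
  by rewrite scalerBl xy subrr.
have [||a0|a1] := connA a.
- by apply: aeq => q; rewrite -scalerA !aq bm_rlK scalerA ee.
- by move=> x; apply: aeq => q; rewrite -!scalerA !aq bm_comm.
- by left; apply: faithB => m; rewrite aE a0 scale0r bm_lr0.
- right; apply/eqP; rewrite -subr_eq0; apply/eqP/faithB => m.
  by rewrite scalerBl aE a1 !scale1r bm_rlK subrr.
Qed.

Theorem corollary4p14 (K : fieldType) (A : falgType K)
    (Aconn : connected_ring A) (Aaus : higher_Auslander A) (AQF1 : QF1 A) :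
  exists (n : nat) (B : falgType K) (M : lmodType B),
    [/\ (1 <= n)%N, connected_ring B, cluster_tilting n M,
        is_End_algebra A M
      & forall N : lmodType B, fin_gen N -> indecomposable N ->
          direct_summand N M -> projective N \/ injective_module N].
Proof.
have [n [N [n0 fN iN gdA ddA]]] := higher_Auslander_data Aaus.
(* The regular module embeds in a summand of a power of [N], so [N = 0] would give [1 = 0] in
   [A]. *)
have nzN : ~ zero_module N.
  move=> N0; have [I [_ [i [_ [[ii _ _] [k [s [r rs]]] _]]]]] := ddA.
  have /ii/eqP : i (1 : A^o) = i 0.
    by rewrite -[LHS]rs -[RHS]rs; congr (r _); apply/ffunP => j; rewrite [LHS]N0 [RHS]N0.
  by rewrite oner_eq0.
have [B [Q [QN fQB full faithB scal]]] := endomorphism_bimod fN.1 nzN.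
rewrite -QN in fN iN ddA.
have noeA := @falg_noeth K A; have noeB := @falg_noeth K B.
have faithA : faithful_module (bm_l Q) by exact: QA_faithful ddA.
have dc := double_centralizer fN iN full n0 ddA.
exists n, B, (bm_r Q); split=> //.
- exact: connected_transfer faithA faithB dc Aconn.
- exact: (QB_cluster_tilting noeA noeB fN iN fQB full faithB n0 gdA ddA).
- exists (fun a : A => lin (@act_subproof _ _ Q a)); split.
  + by move=> a b m; rewrite /= scalerDl bm_lrD.
  + by move=> k a m; exact: scal.
  + by split=> [m|a b m] /=; rewrite ?scale1r ?bm_lrK ?bm_rlK // scalerA.
  + move=> a b ab; apply/eqP; rewrite -subr_eq0; apply/eqP/faithA => q.
    rewrite scalerBl; apply/eqP; rewrite subr_eq0; apply/eqP.
    apply: (can_inj (bm_lrK Q)); have := ab (bm_lr Q q).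
    by rewrite /= bm_lrK.
  + by move=> f; have [a aE] := dc f; exists a => m; rewrite aE.
- move=> X fX indX sX.
  apply: (QF1_summand fN iN full faithB faithA AQF1.1 fX indX).
  exact: (G_summand_fgproj fN iN full n0 ddA sX).
Qed.
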